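(* Let $D\subset\mathbb{R}^n$ be a bounded domain with Lipschitz boundary and let $p,q,r$ satisfy $$1\leq p<\infty,\quad 1\leq q<\infty,\quad 1\leq r<\infty,\quad q(2n-p)<2np,\quad q(2n-1)<2nr.$$ Then there is a constant $\delta=\delta(D,p,q,r)>0$ (depending only on $D,p,q,r$) such that $$\delta\|f\|_{L^q(D)}\leq \|\nabla f\|_{L^p(D)}+\|f\|_{L^r(\partial D)},\qquad \forall f\in C^1(\overline D).$$
   Context: A domain is a connected open set. $C^1(\overline D)$ is the space of complex valued functions which are of class $C^1$ in an open neighborhood of $\overline D$; $\nabla f$ is the gradient of $f$. $\|\cdot\|_{L^p(D)}$ is taken with respect to Lebesgue measure, and $\|\cdot\|_{L^r(\partial D)}$ with respect to the $(n-1)$-dimensional Hausdorff (surface) measure on $\partial D$. *)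

(* Defs.v *)
From HB Require Import structures.
From mathcomp Require Import all_boot all_order all_algebra.
From mathcomp Require Import all_classical all_reals all_analysis.
From mathcomp Require Import measurable_realfun complex.

Set Implicit Arguments.
Unset Strict Implicit.
Unset Printing Implicit Defensive.

Import Order.TTheory GRing.Theory Num.Theory.
Import numFieldNormedType.Exports.

Local Open Scope classical_set_scope.
Local Open Scope ring_scope.

Notation borel_rV R n := (g_sigma_algebraType (@open 'rV[R]_n)).

Section lebesgue.
Variable R : realType.

Definition rV_cons n (x : measurableTypeR R * borel_rV R n) : borel_rV R n.+1 :=
  row_mx (x.1%:M : 'rV_1) (x.2 : 'rV_n).

Lemma open_borel_rV n (U : set 'rV[R]_n) :
  open U -> measurable (U : set (borel_rV R n)).
Proof. by move=> oU; exact: sub_sigma_algebra. Qed.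

Lemma rV_consE n (x : R) (v : 'rV[R]_n) (i : 'I_n.+1) :
  rV_cons (x, v) ord0 i = if unlift ord0 i is Some j then v ord0 j else x.
Proof.
rewrite /rV_cons/= mxE; case: unliftP => [j ->|->].
  case: split_ordP => k /(congr1 val)/=; rewrite /bump /= add1n.
    by case: k => [[|//]].
  by rewrite add1n => -[jk]; rewrite (_ : k = j) //; apply: val_inj.
case: split_ordP => k /(congr1 val)//= _.
by rewrite (ord1 k) !mxE eqxx mulr1n.
Qed.

Lemma measurable_rV_cons n : measurable_fun setT (@rV_cons n).
Proof.
pose box (ck : 'rV[rat]_n.+1 * nat) : set 'rV[R]_n.+1 :=
  ball (map_mx ratr ck.1 : 'rV[R]_n.+1) ck.2.+1%:R^-1.
have box_center (U : set 'rV[R]_n.+1) v : open U -> U v ->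
    exists ck, box ck `<=` U /\ box ck v.
  move=> oU Uv; have /nbhs_ballP[e/= e0 eU] : nbhs v U by exact: open_nbhs_nbhs.
  have e20 : 0 < e / 2 by rewrite divr_gt0.
  have [k ke] : exists k : nat, k.+1%:R^-1 < e / 2.
    have [k _ hk] := near_infty_natSinv_lt (PosNum e20).
    by exists k; exact: (hk k (leqnn k)).
  have /choice[c cv] : forall i, exists c : rat,
      ball (v ord0 i) k.+1%:R^-1 (ratr c : R).
    move=> i; have /dense_rat : (ball (v ord0 i) (k.+1%:R^-1 : R)) !=set0.
      by exists (v ord0 i); exact: ballxx.
    case=> [|y [By [c _ cy]]]; first exact: ball_open.
    by exists c; rewrite cy.
  exists (\row_i c i, k).
  have bv : box (\row_i c i, k) v.
    split; first by rewrite /= invr_gt0.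
    by move=> i j; rewrite !mxE (ord1 i); exact/ball_sym.
  split=> // w bw; apply: eU; rewrite (splitr e).
  apply: ball_triangle.
    by apply: le_ball (ltW ke) _ _; exact/ball_sym/bv.
  exact: le_ball (ltW ke) _ bw.
apply: (@measurability _ _ _ (borel_rV R n.+1) _ _ (@open 'rV[R]_n.+1)) => // _ [U oU <-]; rewrite setTI.
have -> : @rV_cons n @^-1` U = \bigcup_ck
    (if `[< box ck `<=` U >] then @rV_cons n @^-1` box ck else set0).
  apply/seteqP; split=> [x Ux|x [ck _]]; last first.
    by case: asboolP => // bU bx; exact: bU.
  have [ck [bU bx]] := box_center _ _ oU Ux.
  by exists ck => //; case: asboolP.
apply: countable_bigcupT_measurable; first exact: countableP.
move=> [c k]; case: ifPn => // _.
have -> : @rV_cons n @^-1` box (c, k) =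
    ball (ratr (c ord0 ord0) : R) k.+1%:R^-1 `*`
    ball (\row_j ratr (c ord0 (lift ord0 j)) : 'rV[R]_n) k.+1%:R^-1.
  apply/seteqP; split=> [[x v] [k0 bxv]|[x v] [/= bx [k0 bv]]].
    split=> /=.
      by have := bxv ord0 ord0; rewrite rV_consE unlift_none mxE.
    split=> // i j; have := bxv ord0 (lift ord0 j).
    by rewrite rV_consE liftK !mxE (ord1 i).
  split=> // i j; rewrite (ord1 i) rV_consE mxE.
  case: unliftP => [l ->|->//].
  by have := bv ord0 l; rewrite mxE.
apply: measurableX; first by apply: open_measurable; exact: ball_open.
by apply: open_borel_rV; exact: ball_open.
Qed.

Lemma sigma_finite_rV_cons n (m : {sigma_finite_measure set (borel_rV R n) -> \bar R}) :
  sigma_finite setT (pushforward (lebesgue_measure \x m)%E (@rV_cons n)).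
Proof.
have /sigma_finiteP[F [TF ndF Foo]] := sigma_finiteT (@lebesgue_measure R).
have /sigma_finiteP[G [TG ndG Goo]] := sigma_finiteT m.
pose tl (v : 'rV[R]_n.+1) : 'rV[R]_n := \row_j v ord0 (lift ord0 j).
have mhd : measurable_fun setT ((fun v => v ord0 ord0) : borel_rV R n.+1 -> R).
  apply: (measurability _ (RGenOInfty.measurableE R)) => _ [_ [a ->] <-].
  rewrite setTI; apply: open_borel_rV.
  by apply: open_comp => [v _|]; [exact: coord_continuous|exact: interval_open].
have mtl : measurable_fun setT (tl : borel_rV R n.+1 -> borel_rV R n).
  apply: (@measurability _ _ _ (borel_rV R n) _ _ (@open 'rV[R]_n)) => // _ [U oU <-].
  rewrite setTI; apply: open_borel_rV; rewrite openE => v /= Uv.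
  have /nbhs_ballP[e/= e0 eU] : nbhs (tl v) U by exact: open_nbhs_nbhs.
  apply/nbhs_ballP; exists e => //= w [_ bvw]; apply: eU; split=> // i j.
  by rewrite !mxE; exact: bvw.
have tlK (x : R) (v : 'rV[R]_n) : tl (rV_cons (x, v)) = v.
  by apply/rowP => j; rewrite mxE rV_consE liftK.
have hdK (x : R) (v : 'rV[R]_n) : rV_cons (x, v) ord0 ord0 = x.
  by rewrite rV_consE unlift_none.
pose H k : set (borel_rV R n.+1) := (fun v : 'rV[R]_n.+1 => v ord0 ord0) @^-1` F k `&` tl @^-1` G k.
exists H.
  apply/seteqP; split=> // v _.
  have [i _ Fi] : (\bigcup_k F k) (v ord0 ord0) by rewrite -TF.
  have [j _ Gj] : (\bigcup_k G k) (tl v) by rewrite -TG.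
  exists (maxn i j) => //; split => /=.
    by move: Fi; exact/subsetPset/ndF/leq_maxl.
  by move: Gj; exact/subsetPset/ndG/leq_maxr.
move=> k; have [mF Fk] := Foo k; have [mG Gk] := Goo k; split.
  apply: measurableI; first by rewrite -[X in measurable X]setTI; exact: mhd.
  by rewrite -[X in measurable X]setTI; exact: mtl.
rewrite /pushforward (_ : _ @^-1` _ = F k `*` G k); last first.
  by apply/seteqP; split=> -[x v]; rewrite /H /preimage/= hdK tlK.
by rewrite product_measure1E// lte_mul_pinfty// ge0_fin_numE.
Qed.

Section lebesgue_rV_succ.
Variables (n : nat) (m : {sigma_finite_measure set (borel_rV R n) -> \bar R}).

Definition lebesgue_rV_succ : set (borel_rV R n.+1) -> \bar R :=
  pushforward (lebesgue_measure \x m)%E (@rV_cons n).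

HB.instance Definition _ := Measure.copy lebesgue_rV_succ
  (measure_function_pushforward__canonical__measure_function_Measure
    (lebesgue_measure \x m)%E (@measurable_rV_cons n)).
HB.instance Definition _ := Measure_isSigmaFinite.Build _ _ _ lebesgue_rV_succ
  (sigma_finite_rV_cons m).
End lebesgue_rV_succ.

(* R^(k+1) is identified with R * R^k, so this is the n-fold product of the
   one-dimensional Lebesgue measure, on the Borel sets of 'rV[R]_n *)
Fixpoint lebesgue_rV n : {sigma_finite_measure set (borel_rV R n) -> \bar R} :=
  if n is k.+1 then lebesgue_rV_succ (lebesgue_rV k)
  else \d_ ((0 : 'rV[R]_0) : borel_rV R 0).

End lebesgue.

Section hausdorff.
Variables (R : realType) (n : nat).
Local Open Scope ereal_scope.

Definition enorm k (x : 'rV[R]_k) : R :=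
  Num.sqrt (\sum_(i < k) x ord0 i ^+ 2)%R.

(* 0 is included so that the empty set has diameter 0 rather than -oo *)
Definition ediam (A : set 'rV[R]_n) : \bar R :=
  ereal_sup (0 |` [set (enorm (x - y))%:E | x in A & y in A]).

(* volume of the Euclidean unit ball of R^s; it normalizes the Hausdorff measure
   so that it agrees with surface area *)
Fixpoint ball_volume (s : nat) : R :=
  match s with
  | 0 => 1
  | 1 => 2
  | k.+2 => 2 * pi / k.+2%:R * ball_volume k
  end%R.

(* the test for the empty set matters for s = 0, where x ^+ 0 = 1 *)
Definition hausdorff_gauge (s : nat) (A : set 'rV[R]_n) : \bar R :=
  if A == set0 then 0 else (ball_volume s / 2 ^+ s)%:E * ediam A ^+ s.

Definition hausdorff_delta (s : nat) (d : R) (A : set 'rV[R]_n) : \bar R :=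
  ereal_inf [set \sum_(k <oo) hausdorff_gauge s (F k) | F in
    [set F : (set 'rV[R]_n)^nat |
      (forall k, ediam (F k) <= d%:E) /\ A `<=` \bigcup_k F k]].

Definition hausdorff (s : nat) (A : set 'rV[R]_n) : \bar R :=
  ereal_sup [set hausdorff_delta s d A | d in [set d : R | (0 < d)%R]].

Lemma ediam_ge0 A : 0 <= ediam A.
Proof. by apply: ereal_sup_ubound; left. Qed.

Lemma le_ediam A B : A `<=` B -> ediam A <= ediam B.
Proof.
move=> AB; apply: ereal_sup_le => _ [->|[x Ax [y Ay <-]]]; first by left.
by right; exists x; [exact: AB|exists y; [exact: AB|]].
Qed.

Lemma ediam0 : ediam set0 = 0.
Proof.
apply/eqP; rewrite eq_le ediam_ge0 andbT.
by apply: ge_ereal_sup => _ [->|[x []]].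
Qed.

Lemma ball_volume_ge0 s : (0 <= ball_volume s)%R.
Proof.
suff : (0 <= ball_volume s)%R /\ (0 <= ball_volume s.+1)%R by case.
elim: s => [|s [s0 s1]] //=; split=> //.
by rewrite mulr_ge0// divr_ge0// mulr_ge0// pi_ge0.
Qed.

Lemma hausdorff_gauge_ge0 s A : 0 <= hausdorff_gauge s A.
Proof.
rewrite /hausdorff_gauge; case: ifPn => // _.
rewrite mule_ge0 ?expe_ge0 ?ediam_ge0// lee_fin divr_ge0 ?ball_volume_ge0//.
Qed.

Let hausdorff_gauge0 s : hausdorff_gauge s set0 = 0.
Proof. by rewrite /hausdorff_gauge eqxx. Qed.

(* Sets of diameter at most d form a semiring, so the generic outer measure
   construction applies *)
Lemma hausdorff_delta_outer s (d : R) : (0 < d)%R ->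
  hausdorff_delta s d set0 = 0 /\ (forall A, 0 <= hausdorff_delta s d A) /\
  {homo hausdorff_delta s d : A B / A `<=` B >-> A <= B} /\
  sigma_subadditive (hausdorff_delta s d).
Proof.
move=> d0; pose M := [set A : set 'rV[R]_n | ediam A <= d%:E].
have M0 : M set0 by rewrite /M/= ediam0 lee_fin ltW.
have MI : setI_closed M.
  by move=> A B MA _; apply: le_trans MA; apply: le_ediam; exact: subIsetl.
have MD : semi_setD_closed M.
  move=> A B MA _; exists [set A `\` B]; split=> //.
  - by move=> _ ->; apply: le_trans MA; apply: le_ediam; exact: subDsetl.
  - by rewrite bigcup_set1.
  - by move=> _ _ -> ->.
pose mix := isSemiRingOfSets.Build default_measure_display 'rV[R]_n M0 MI MD.
pose T : semiRingOfSetsType default_measure_display := HB.pack 'rV[R]_n mix.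
pose g : set T -> \bar R := hausdorff_gauge s.
have g0 : g set0 = 0 by exact: hausdorff_gauge0.
have gge0 A : 0 <= g A by exact: hausdorff_gauge_ge0.
split; [exact: (mu_ext0 g0 gge0)|split; [exact: (mu_ext_ge0 gge0)|split]].
- exact: (le_mu_ext g).
- exact: (mu_ext_sigma_subadditive gge0).
Qed.

Let hausdorff0 s : hausdorff s set0 = 0.
Proof.
apply/eqP; rewrite eq_le; apply/andP; split.
  by apply: ge_ereal_sup => _ [d d0 <-]; rewrite (hausdorff_delta_outer s d0).1.
apply: (@le_trans _ _ (hausdorff_delta s 1 set0)).
  by rewrite (hausdorff_delta_outer s ltr01).1.
by apply: ereal_sup_ubound; exists 1%R => //=.
Qed.

Let hausdorff_ge0 s A : 0 <= hausdorff s A.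
Proof.
apply: (@le_trans _ _ (hausdorff_delta s 1 A)).
  exact: (hausdorff_delta_outer s ltr01).2.1.
by apply: ereal_sup_ubound; exists 1%R => //=.
Qed.

Let le_hausdorff s : {homo hausdorff s : A B / A `<=` B >-> A <= B}.
Proof.
move=> A B AB; apply: ge_ereal_sup => _ [d d0 <-].
apply: (@le_trans _ _ (hausdorff_delta s d B)).
  exact: (hausdorff_delta_outer s d0).2.2.1.
by apply: ereal_sup_ubound; exists d.
Qed.

Let hausdorff_sigma_subadditive s : sigma_subadditive (hausdorff s).
Proof.
move=> F; apply: ge_ereal_sup => _ [d d0 <-].
apply: le_trans ((hausdorff_delta_outer s d0).2.2.2 F) _.
apply: lee_nneseries => [k _ _|k _].
  exact: (hausdorff_delta_outer s d0).2.1.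
by apply: ereal_sup_ubound; exists d.
Qed.

HB.instance Definition _ s := isOuterMeasure.Build R _ (hausdorff s)
  (hausdorff0 s) (hausdorff_ge0 s) (@le_hausdorff s)
  (hausdorff_sigma_subadditive s).

End hausdorff.

Definition caratheodory_measure (R : realType) (T : pointedType)
    (mu : {outer_measure set T -> \bar R}) :
  {measure set (caratheodory_type mu) -> \bar R} := mu.

Section domains.
Variables (R : realType) (n : nat).
Implicit Types D : set 'rV[R]_n.

Definition domain D := open D /\ connected D.

Definition boundary D : set 'rV[R]_n := closure D `\` interior D.

(* After an orthogonal change of coordinates Q (acting on row vectors), D is,
   near each boundary point, the set lying above the graph of a Lipschitz
   function phi of the coordinates other than the j-th. [lipschitz] refers to
   the sup norm of 'rV[R]_n.-1, which only affects the Lipschitz constant. *)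
Definition lipschitz_boundary D := forall x, boundary D x ->
  exists (Q : 'M[R]_n) (j : 'I_n) (phi : 'rV[R]_n.-1 -> R),
  [/\ Q *m Q^T = 1%:M, lipschitz (phi : _ -> R^o) &
    \forall y \near x, D y <-> phi (col' j (y *m Q)) < (y *m Q) ord0 j].

End domains.

(* R[i] carries no normed space structure over R, so complex-valued functions
   are differentiated through their real and imaginary parts. *)
Section complex_functions.
Variables (R : realType) (n : nat).
Implicit Types (U D : set 'rV[R]_n) (g : 'rV[R]_n -> R) (f : 'rV[R]_n -> R[i]).

Definition partial (j : 'I_n) g : 'rV[R]_n -> R :=
  'D_(delta_mx ord0 j) (g : _ -> R^o).

Definition C1_on U g := forall x j, U x ->
  derivable (g : _ -> R^o) x (delta_mx ord0 j) /\
  {for x, continuous (partial j g)}.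

Definition C1_closure D f := exists U, [/\ open U, closure D `<=` U,
  C1_on U (fun x => complex.Re (f x)) & C1_on U (fun x => complex.Im (f x))].

Definition grad f (x : 'rV[R]_n) : 'rV[R[i]]_n :=
  \row_j Complex (partial j (fun y => complex.Re (f y)) x)
                 (partial j (fun y => complex.Im (f y)) x).

Definition cnorm k (z : 'rV[R[i]]_k) : R :=
  Num.sqrt (\sum_(j < k) ComplexField.Normc.normc (z ord0 j) ^+ 2).

End complex_functions.

Section Lp_norms.
Variables (R : realType) (n : nat).
Local Open Scope ereal_scope.
Implicit Types (D : set 'rV[R]_n) (p : R) (g : 'rV[R]_n -> R).

Definition Lp_domain D p g : \bar R :=
  'N[lebesgue_rV R n]_p%:E [ EFin \o (g \_ D) ].

Definition Lp_boundary D p g : \bar R :=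
  'N[caratheodory_measure (@hausdorff R n n.-1)]_p%:E
    [ EFin \o (g \_ (boundary D)) ].

End Lp_norms.

(* Main.v *)
Require Import Defs.
From mathcomp Require Import all_boot all_order all_algebra.
From mathcomp Require Import all_classical all_reals all_analysis.
From mathcomp Require Import complex measurable_realfun ring lra zify.

Set Implicit Arguments.
Unset Strict Implicit.
Unset Printing Implicit Defensive.

Import Order.TTheory GRing.Theory Num.Theory.
Import numFieldNormedType.Exports ComplexField.Normc.

Local Open Scope classical_set_scope.
Local Open Scope ring_scope.

(* Extend |f| by zero outside D and let s = max(1, q n/(n+1)), so that s <= r.
   For x in D follow the line x + R e_i until it leaves D or meets a zero of f:
   the fundamental theorem of calculus bounds |f(x)|^s by
     (integral of s |f|^(s-1) |grad f| over the line) + |f(b)|^s,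
   where b is a boundary point on the line.  Neither term depends on x_i, so a
   Gagliardo-Nirenberg induction on n bounds the L^((n+1)/n) norm of |f|^s by
   their integrals.  The boundary terms are controlled by the surface integral
   of |f|^r because the projection along e_i increases H^(n-1) at most by a
   constant factor, as one sees from coverings.  Finally Young's inequality
   absorbs the power |f|^(s-1), since 1/p + (s-1)/(s (n+1)/n) <= 1. *)

(** * Fubini for Lebesgue measure on row vectors *)

(** A line is stopped also at a zero of f because |f|^s need not be differentiable there when s = 1.
    The boundary point b depends on x with no measurability at hand, so its contribution is replaced
    by a measurable function, constant along the line, that dominates |f|^r at every boundary point
    of that line at once; since s <= r, adding 1 to it dominates |f|^s. The exponent (n+1)/n is
    smaller than the usual n/(n-1): it is finite in dimension one, where the induction starts, and
    the hypotheses on p, q, r leave room for it. Young's inequality and the counting of levels both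
    produce additive constants, so the estimate is proved after dividing f by an upper bound for the
    two norms on the right. Absorption needs the absorbed integral to be finite beforehand; this
    holds because f is bounded on the closure of D, and that bound does not enter the constant. *)

Lemma continuous_measurable_borel_rV (R : realType) n (g : 'rV[R]_n -> R) :
  continuous g -> measurable_fun setT (g : borel_rV R n -> R).
Proof.
move=> cg; apply: (measurability _ (RGenOInfty.measurableE R)) => _ [_ [a ->] <-].
rewrite setTI; apply: open_borel_rV.
by apply: open_comp => [v _|]; [exact: cg|exact: interval_open].
Qed.

Lemma measurable_coord_rV (R : realType) n (i : 'I_n) :
  measurable_fun setT ((fun v => v ord0 i) : borel_rV R n -> R).
Proof.
by apply: continuous_measurable_borel_rV => v; exact: coord_continuous.
Qed.

(** The sigma-algebra of [borel_rV] is generated by open sets, not by the coordinates. Coordinates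
    suffice because a vector is rebuilt from its head and tail by the measurable map [rV_cons]. *)
Lemma measurable_fun_to_rV (R : realType) n d (T : measurableType d)
    (g : T -> borel_rV R n) :
  (forall i, measurable_fun setT (fun t => (g t : 'rV[R]_n) ord0 i)) ->
  measurable_fun setT g.
Proof.
elim: n g => [|n IH] g mg.
  rewrite (_ : g = cst (0 : 'rV[R]_0)); first exact: measurable_cst.
  by apply/funext => t; apply/rowP => -[].
pose tl t : borel_rV R n := (\row_j (g t : 'rV[R]_n.+1) ord0 (lift ord0 j) : 'rV[R]_n).
rewrite (_ : g = @rV_cons R n \o (fun t => ((g t : 'rV[R]_n.+1) ord0 ord0, tl t))).
  apply: measurableT_comp; first exact: measurable_rV_cons.
  apply/measurable_fun_pairP; split => //=; first exact: (mg ord0).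
  apply: IH => i; rewrite /comp/=.
  under eq_fun do rewrite mxE.
  exact: mg.
apply/funext => t; apply/rowP => i; rewrite rV_consE /=.
by case: unliftP => [j ->|->] //; rewrite mxE.
Qed.

Lemma integral_lebesgue_rVS (R : realType) n (g : borel_rV R n.+1 -> \bar R) :
  measurable_fun setT g -> (forall x, 0 <= g x)%E ->
  (\int[lebesgue_rV R n.+1]_x g x =
   \int[@lebesgue_measure R]_t \int[lebesgue_rV R n]_v g (rV_cons (t, v)))%E.
Proof.
move=> mg g0; rewrite /=.
rewrite (ge0_integral_pushforward (@measurable_rV_cons R n)) //.
rewrite preimage_setT fubini_tonelli1 //.
  by apply: measurableT_comp => //; exact: measurable_rV_cons.
by move=> x; exact: g0.
Qed.

Lemma measurable_integral_rV_slice (R : realType) n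
    (g : borel_rV R n.+1 -> \bar R) :
  measurable_fun setT g -> (forall x, 0 <= g x)%E ->
  measurable_fun setT ((fun t => \int[lebesgue_rV R n]_v g (rV_cons (t, v)))%E
    : measurableTypeR R -> \bar R).
Proof.
move=> mg g0.
apply: (@measurable_fun_fubini_tonelli_F _ _ _ _ _ (lebesgue_rV R n)
  (fun z => g (rV_cons z))) => //.
by apply: measurableT_comp => //; exact: measurable_rV_cons.
Qed.

Lemma measurable_rV_slice (R : realType) n d (T : measurableType d)
    (g : borel_rV R n.+1 -> T) (t : R) :
  measurable_fun setT g ->
  measurable_fun setT ((fun v => g (rV_cons (t, v))) : borel_rV R n -> T).
Proof.
move=> mg; apply: (measurableT_comp mg).
apply: (measurableT_comp (@measurable_rV_cons R n)).
exact: measurable_pair1.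
Qed.

(** As t varies this runs through the line x + R e_i. That a function does not depend on the i-th
    coordinate is expressed throughout as invariance under [rV_set], which avoids passing to vectors
    of smaller length. *)
Definition rV_set (R : realType) n (x : 'rV[R]_n) (i : 'I_n) (t : R) : 'rV[R]_n :=
  \row_j if j == i then t else x ord0 j.

Lemma rV_set0_cons (R : realType) n (a t : R) (v : 'rV[R]_n) :
  rV_set (rV_cons (a, v)) ord0 t = rV_cons (t, v).
Proof.
apply/rowP => j; rewrite mxE !rV_consE; case: unliftP => [k ->|->].
  by rewrite eq_sym (negbTE (neq_lift _ _)).
by rewrite eqxx.
Qed.

Lemma rV_setS_cons (R : realType) n (a t : R) (v : 'rV[R]_n) (i : 'I_n) :
  rV_set (rV_cons (a, v)) (lift ord0 i) t = rV_cons (a, rV_set v i t).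
Proof.
apply/rowP => j; rewrite mxE !rV_consE; case: unliftP => [k ->|->].
  by rewrite mxE (inj_eq (@lift_inj _ _)).
by rewrite (negbTE (neq_lift _ _)).
Qed.

Lemma rV_set_set (R : realType) n (x : 'rV[R]_n) (i : 'I_n) (s t : R) :
  rV_set (rV_set x i s) i t = rV_set x i t.
Proof. by apply/rowP => j; rewrite !mxE; case: eqP. Qed.

Lemma rV_set_id (R : realType) n (x : 'rV[R]_n) (i : 'I_n) :
  rV_set x i (x ord0 i) = x.
Proof. by apply/rowP => j; rewrite !mxE; case: eqP => [->|]. Qed.

Lemma measurable_rV_set (R : realType) n (i : 'I_n) :
  measurable_fun setT ((fun z => rV_set z.1 i z.2)
    : borel_rV R n * measurableTypeR R -> borel_rV R n).
Proof.
apply: measurable_fun_to_rV => j.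
under eq_fun do rewrite mxE.
case: eqP => _; first exact: measurable_snd.
by apply: (measurableT_comp (@measurable_coord_rV R n j)); exact: measurable_fst.
Qed.

Definition line_integral (R : realType) n (g : 'rV[R]_n -> \bar R) (i : 'I_n)
  (x : 'rV[R]_n) : \bar R := (\int[@lebesgue_measure R]_t g (rV_set x i t))%E.

Lemma line_integral_ge0 (R : realType) n (g : 'rV[R]_n -> \bar R) i x :
  (forall x, 0 <= g x)%E -> (0 <= line_integral g i x)%E.
Proof. by move=> g0; apply: integral_ge0. Qed.

Lemma measurable_line_integral (R : realType) n
    (g : borel_rV R n -> \bar R) (i : 'I_n) :
  measurable_fun setT g -> (forall x, 0 <= g x)%E ->
  measurable_fun setT (line_integral g i : borel_rV R n -> \bar R).
Proof.
move=> mg g0.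
apply: (@measurable_fun_fubini_tonelli_F _ _ _ _ _ (@lebesgue_measure R)
  (fun z : borel_rV R n * measurableTypeR R => g (rV_set z.1 i z.2))) => //.
by apply: (measurableT_comp mg); exact: measurable_rV_set.
Qed.

Lemma line_integral_set (R : realType) n (g : 'rV[R]_n -> \bar R) i x t :
  line_integral g i (rV_set x i t) = line_integral g i x.
Proof. by apply: eq_integral => s _; rewrite rV_set_set. Qed.

(** Functions that are constant along lines are in general not integrable over the whole space, so
    they are integrated over a cube containing D. *)
Definition cube (R : realType) n (L : R) : set 'rV[R]_n :=
  [set x | forall i, `|x ord0 i| <= L].

Lemma measurable_norm_coord (R : realType) n (i : 'I_n) (a L : R) :
  measurable ([set x : 'rV[R]_n | `|x ord0 i - a| <= L] : set (borel_rV R n)).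
Proof.
have -> : [set x : 'rV[R]_n | `|x ord0 i - a| <= L] =
   (fun v : 'rV[R]_n => v ord0 i) @^-1` `[a - L, a + L].
  by apply/seteqP; split => x /=; rewrite in_itv/= ler_distl.
rewrite -[X in measurable X]setTI.
exact: measurable_coord_rV.
Qed.

Lemma measurable_cube (R : realType) n (L : R) :
  measurable (cube L : set (borel_rV R n)).
Proof.
rewrite (_ : cube L = \bigcap_(i : 'I_n) [set x : 'rV[R]_n | `|x ord0 i - 0| <= L]).
  by apply: fin_bigcap_measurable => // i _; exact: measurable_norm_coord.
apply/seteqP; split => [x xL i _|x xL i] /=; first by rewrite subr0; exact: xL.
by have := xL i I; rewrite /= subr0.
Qed.

Lemma cube_cons (R : realType) n (L t : R) (v : 'rV[R]_n) :
  cube L (rV_cons (t, v)) <-> `|t| <= L /\ cube L v.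
Proof.
split => [h|[h1 h2] i].
  split; first by have := h ord0; rewrite rV_consE unlift_none.
  by move=> i; have := h (lift ord0 i); rewrite rV_consE liftK.
by rewrite rV_consE; case: unliftP => [j _|_].
Qed.

Lemma integral_cubeS (R : realType) n (L : R) (g : borel_rV R n.+1 -> \bar R) :
  measurable_fun setT g -> (forall x, 0 <= g x)%E ->
  (\int[lebesgue_rV R n.+1]_(x in cube L) g x =
   \int[@lebesgue_measure R]_(t in `[(- L)%R, L])
      \int[lebesgue_rV R n]_(v in cube L) g (rV_cons (t, v)))%E.
Proof.
move=> mg g0; rewrite integral_mkcond integral_lebesgue_rVS; last 2 first.
- by apply/(measurable_restrictT _ _).1 => //; [exact: measurable_cube|exact: measurable_funTS].
- by move=> x; rewrite patchE; case: ifP.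
rewrite [RHS]integral_mkcond; apply: eq_integral => t _.
rewrite patchE; case: ifPn; rewrite ?inE ?notin_setE/= in_itv/= -ler_norml => tL.
  rewrite [RHS]integral_mkcond; apply: eq_integral => v _.
  rewrite !patchE; congr (if _ then _ else _); apply/idP/idP; rewrite !inE.
    by case/cube_cons.
  by move=> ?; apply/cube_cons.
apply: integral0_eq => v _; rewrite patchE; case: ifPn => //.
by rewrite inE => /cube_cons[].
Qed.

Lemma measurable_integral_cube_slice (R : realType) n (L : R)
    (g : borel_rV R n.+1 -> \bar R) :
  measurable_fun setT g -> (forall x, 0 <= g x)%E ->
  measurable_fun setT
    ((fun t => \int[lebesgue_rV R n]_(v in cube L) g (rV_cons (t, v)))%E
    : measurableTypeR R -> \bar R).
Proof.
move=> mg g0.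
under eq_fun do rewrite integral_mkcond.
apply: (@measurable_fun_fubini_tonelli_F _ _ _ _ _ (lebesgue_rV R n)
  (fun z : measurableTypeR R * borel_rV R n =>
     ((fun v => g (rV_cons (z.1, v))) \_ (cube L)) z.2)) => //.
- rewrite (_ : (fun z => _) = (g \o @rV_cons R n) \_ (setT `*` cube L)).
    apply/(measurable_restrictT _ _).1.
      by apply: measurableX => //; exact: measurable_cube.
    apply: measurable_funTS; apply: (measurableT_comp mg).
    exact: measurable_rV_cons.
  apply/funext => -[t v]; rewrite !patchE /=; congr (if _ then _ else _).
  by apply/idP/idP; rewrite !inE/=; [split|case].
- by move=> z; rewrite patchE; case: ifP.
Qed.

(** * A Gagliardo-Nirenberg inequality on cubes *)

Lemma lebesgue_measure_centered_itv (R : realType) (a L : R) : 0 <= L ->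
  @lebesgue_measure R `[a - L, a + L]%classic = (2 * L)%:E.
Proof.
move=> L0; rewrite lebesgue_measure_itv/= lte_fin.
case: ifPn => [_|]; first by rewrite -EFinD; congr EFin; ring.
by rewrite -leNgt => *; congr EFin; lra.
Qed.

Lemma lebesgue_measure_symitv (R : realType) (L : R) : 0 <= L ->
  @lebesgue_measure R `[- L, L]%classic = (2 * L)%:E.
Proof.
by move=> L0; rewrite -(lebesgue_measure_centered_itv 0 L0) sub0r add0r.
Qed.

Lemma lebesgue_rV_box (R : realType) n (a : 'rV[R]_n) (rho : 'I_n -> R) :
  (forall i, 0 <= rho i) ->
  lebesgue_rV R n [set x : 'rV[R]_n | forall i, `|x ord0 i - a ord0 i| <= rho i] =
  (\prod_i (2 * rho i))%:E.
Proof.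
elim: n a rho => [|n IH] a rho rho0.
  by rewrite big_ord0 /= diracE mem_set// => -[].
rewrite big_ord_recl /= /lebesgue_rV_succ /pushforward.
rewrite (_ : _ @^-1` _ = `[a ord0 ord0 - rho ord0, a ord0 ord0 + rho ord0] `*`
   [set v : 'rV[R]_n | forall i, `|v ord0 i - (\row_j a ord0 (lift ord0 j)) ord0 i|
      <= rho (lift ord0 i)]); last first.
  apply/seteqP; split => [[t v] /= h|[t v] /= [h1 h2] i].
    split.
      by have := h ord0; rewrite rV_consE unlift_none in_itv/= ler_distl.
    by move=> i; have := h (lift ord0 i); rewrite rV_consE liftK mxE.
  rewrite rV_consE; case: unliftP => [j ->|->].
    by have := h2 j; rewrite mxE.
  by move: h1; rewrite in_itv/= ler_distl.
rewrite product_measure1E//; last first.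
  rewrite (_ : [set v | _] = \bigcap_(i : 'I_n) [set x : 'rV[R]_n |
      `|x ord0 i - (\row_j a ord0 (lift ord0 j)) ord0 i| <= rho (lift ord0 i)]).
    by apply: fin_bigcap_measurable => // i _; exact: measurable_norm_coord.
  by apply/seteqP; split => [x h i _|x h i]; [exact: h|exact: (h i I)].
rewrite IH// EFinM; congr (_ * _)%E.
exact: lebesgue_measure_centered_itv.
Qed.

Lemma lebesgue_rV_cube (R : realType) n (L : R) : 0 <= L ->
  lebesgue_rV R n (cube L) = ((2 * L) ^+ n)%:E.
Proof.
move=> L0; have := @lebesgue_rV_box R n 0 (fun=> L) (fun=> L0).
rewrite prodr_const card_ord => <-; congr (lebesgue_rV R n _).
by apply/seteqP; split => x h i; have := h i; rewrite mxE subr0.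
Qed.

(** The line integral is constant in the i-th coordinate, whose range in the cube has length 2L;
    integrating over the remaining coordinates recovers at most the full integral by Tonelli. The
    induction peels off leading coordinates until i is the first one. *)
Lemma integral_cube_line_integral_le (R : realType) n (L : R)
    (g : borel_rV R n -> \bar R) (i : 'I_n) :
  0 <= L -> measurable_fun setT g -> (forall x, 0 <= g x)%E ->
  (\int[lebesgue_rV R n]_(x in cube L) line_integral g i x <=
   (2 * L)%:E * \int[lebesgue_rV R n]_x g x)%E.
Proof.
move=> L0; elim: n g i => [|n IH] g i mg g0; first by case: i.
rewrite integral_cubeS; last 2 first.
- exact: measurable_line_integral.
- by move=> x; exact: line_integral_ge0.
rewrite [in leRHS]integral_lebesgue_rVS//.
case: (unliftP ord0 i) => [j|] ->.
  apply: (@le_trans _ _ (\int[@lebesgue_measure R]_t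
     ((2 * L)%:E * \int[lebesgue_rV R n]_v g (rV_cons (t, v))))%E).
    rewrite integral_mkcond; apply: ge0_le_integral => //.
    - move=> t _; rewrite patchE; case: ifP => // _.
      by apply: integral_ge0 => v _; apply: line_integral_ge0.
    - apply/(measurable_restrictT _ _).1 => //.
      apply: measurable_funTS; apply: measurable_integral_cube_slice.
        exact: measurable_line_integral.
      by move=> x; exact: line_integral_ge0.
    - by apply: measurable_funeM; exact: measurable_integral_rV_slice.
    - move=> t _; rewrite patchE; case: ifPn => _; last first.
        by rewrite mule_ge0 ?lee_fin ?mulr_ge0// integral_ge0.
      have := IH (fun v => g (rV_cons (t, v))) j (measurable_rV_slice t mg) (fun v => g0 _).
      apply: le_trans; rewrite le_eqVlt; apply/orP; left; apply/eqP.
      by apply: eq_integral => v _; apply: eq_integral => s _; rewrite rV_setS_cons.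
  rewrite ge0_integralZl//; last by rewrite lee_fin mulr_ge0.
    exact: measurable_integral_rV_slice.
  by move=> t _; exact: integral_ge0.
have E (t : R) : (\int[lebesgue_rV R n]_(v in cube L) line_integral g ord0 (rV_cons (t, v))
    = \int[lebesgue_rV R n]_(v in cube L) \int[@lebesgue_measure R]_s g (rV_cons (s, v)))%E.
  by apply: eq_integral => v _; apply: eq_integral => s _; rewrite rV_set0_cons.
under eq_integral do rewrite E.
rewrite integral_cst; last exact: measurable_itv.
rewrite [X in (_ * X <= _)%E]lebesgue_measure_symitv// muleC lee_wpmul2l//.
  by rewrite lee_fin mulr_ge0.
rewrite (@fubini_tonelli _ _ _ _ _ (@lebesgue_measure R) (lebesgue_rV R n)
  (fun z => g (rV_cons z))); last 2 first.
- by apply: (measurableT_comp mg); exact: measurable_rV_cons.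
- by move=> z; exact: g0.
apply: ge0_subset_integral => //; first exact: measurable_cube.
- apply: (@measurable_fun_fubini_tonelli_G _ _ _ _ _ (@lebesgue_measure R)
    (fun z => g (rV_cons z))) => //.
  by apply: (measurableT_comp mg); exact: measurable_rV_cons.
- by move=> v _; exact: integral_ge0.
Qed.

(** The weighted geometric mean is at most the larger of the two numbers. The sum without weights is
    a crude form of Young's inequality, enough because constants are irrelevant here. *)
Lemma powR_mul_le_add (R : realType) (x y a b : R) :
  0 <= x -> 0 <= y -> 0 <= a -> 0 <= b -> a + b = 1 ->
  x `^ a * y `^ b <= x + y.
Proof.
move=> x0 y0 a0 b0 ab.
have h (u v c d : R) : 0 <= u -> u <= v -> 0 <= c -> 0 <= d -> c + d = 1 ->
    u `^ c * v `^ d <= v.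
  move=> u0 uv c0 d0 cd; have v0 := le_trans u0 uv.
  apply: (@le_trans _ _ (v `^ c * v `^ d)).
    by rewrite ler_wpM2r ?powR_ge0// ge0_ler_powR// nnegrE.
  rewrite -powRD; first by rewrite cd powRr1.
  by rewrite cd oner_eq0.
case: (leP x y) => [xy|/ltW yx].
  by apply: (le_trans (h _ _ _ _ x0 xy a0 b0 ab)); rewrite lerDr.
rewrite mulrC; apply: (le_trans (h _ _ _ _ y0 yx b0 a0 _)); last by rewrite lerDl.
by rewrite addrC.
Qed.

(** Hölder's inequality for F^a (F^s)^b up to a factor 2: after division by K1 and K2 the pointwise
    Young inequality is integrated, and each of the two terms contributes at most 1. *)
Lemma integral_powR_interpolation_le (R : realType) d (T : measurableType d)
    (mu : {measure set T -> \bar R}) (D : set T) (F : T -> R) (s a b K1 K2 : R) :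
  measurable D -> measurable_fun setT F -> (forall x, 0 <= F x) ->
  0 < a -> 0 < b -> a + b = 1 -> 0 < s -> 0 < K1 -> 0 < K2 ->
  (\int[mu]_(x in D) (F x)%:E <= K1%:E)%E ->
  (\int[mu]_(x in D) (F x `^ s)%:E <= K2%:E)%E ->
  (\int[mu]_(x in D) (F x `^ (a + s * b))%:E <= (2 * (K1 `^ a * K2 `^ b))%:E)%E.
Proof.
move=> mD mF F0 a0 b0 ab s0 K10 K20 h1 h2.
pose c := K1 `^ a * K2 `^ b.
have c0 : 0 <= c by rewrite mulr_ge0// powR_ge0.
have cK1 : 0 <= c / K1 by rewrite divr_ge0 // ltW.
have cK2 : 0 <= c / K2 by rewrite divr_ge0 // ltW.
have mE : measurable_fun D (EFin \o F).
  by apply/measurable_EFinP; exact: measurable_funTS.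
have mP (r : R) : measurable_fun D (fun x => (F x `^ r)%:E).
  apply/measurable_EFinP; apply: measurable_funTS.
  by apply: (measurableT_comp (@measurable_powR R r)).
apply: (@le_trans _ _ (\int[mu]_(x in D)
   ((c * K1^-1)%:E * (F x)%:E + (c * K2^-1)%:E * (F x `^ s)%:E))%E).
  apply: ge0_le_integral => //.
  - by move=> x _; rewrite lee_fin powR_ge0.
  - by apply: emeasurable_funD; apply: measurable_funeM.
  move=> x _; rewrite -!EFinM -EFinD lee_fin.
  have -> : F x `^ (a + s * b) = c * ((F x / K1) `^ a * ((F x `^ s) / K2) `^ b).
    rewrite !powRM ?powR_ge0 ?invr_ge0 ?(ltW K10) ?(ltW K20)// -powRrM.
    rewrite powRD; last by rewrite gt_eqF ?addr_gt0 ?mulr_gt0.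
    rewrite /c -[in RHS]powR_inv1 ?ltW// -[K2^-1]powR_inv1 ?ltW// -!powRrM !mulN1r !powRN.
    have := powR_gt0 a K10; have := powR_gt0 b K20 => u v.
    by field; rewrite !gt_eqF.
  have := @powR_mul_le_add R (F x / K1) (F x `^ s / K2) a b.
  move=> /(_ (divr_ge0 (F0 x) (ltW K10)) (divr_ge0 (powR_ge0 _ _) (ltW K20))
     (ltW a0) (ltW b0) ab) /(ler_wpM2l c0) /le_trans; apply.
  by rewrite mulrDr -!mulrA ![_^-1 * _]mulrC.
rewrite ge0_integralD//; last 4 first.
- by move=> x _; rewrite -EFinM lee_fin mulr_ge0.
- exact: measurable_funeM.
- by move=> x _; rewrite -EFinM lee_fin mulr_ge0 ?powR_ge0.
- exact: measurable_funeM.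
have F0e x : D x -> (0 <= (F x)%:E)%E by rewrite lee_fin.
have P0e x : D x -> (0 <= (F x `^ s)%:E)%E by rewrite lee_fin powR_ge0.
rewrite !ge0_integralZl//.
apply: (@le_trans _ _ ((c * K1^-1)%:E * K1%:E + (c * K2^-1)%:E * K2%:E)%E).
  by apply: leeD; apply: lee_wpmul2l => //; rewrite lee_fin.
rewrite -!EFinM -EFinD lee_fin !divfK ?gt_eqF// -/c.
by rewrite (_ : 2 * c = c + c)//; ring.
Qed.

(** Induction on the dimension by slicing at x_0 = t. The function [A ord0], independent of t,
    bounds the slice of F in L^1 uniformly in t; the other [A i] bound it in the exponent of the
    lower dimension by induction. Interpolating between the two and integrating over t gives the
    next exponent. *)
Lemma cube_sum_powR_le (R : realType) n (L : R) : 0 < L ->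
  exists2 C : R, 0 < C &
  forall (F : borel_rV R n.+1 -> R) (A : 'I_n.+1 -> borel_rV R n.+1 -> \bar R) (H : R),
  0 < H -> measurable_fun setT F -> (forall x, 0 <= F x) ->
  (forall i, measurable_fun setT (A i)) -> (forall i x, 0 <= A i x)%E ->
  (forall i x t, A i (rV_set x i t) = A i x) ->
  (forall i x, ((F x)%:E <= A i x)%E) ->
  (forall i, \int[lebesgue_rV R n.+1]_(x in cube L) A i x <= H%:E)%E ->
  (\int[lebesgue_rV R n.+1]_(x in cube L) (F x `^ (1 + n.+1%:R^-1))%:E <=
    (C * H `^ (1 + n.+1%:R^-1))%:E)%E.
Proof.
move=> L0; have L20 : 0 < 2 * L by rewrite mulr_gt0.
have mP m (r : R) (F : borel_rV R m -> R) : measurable_fun setT F ->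
    measurable_fun setT (fun x => (F x `^ r)%:E).
  move=> mF; apply/measurable_EFinP.
  by apply: (measurableT_comp (@measurable_powR R r)).
elim: n => [|n [C' C'0 IH]].
  exists (((2 * L)^-1) `^ (1 + 1^-1) * (2 * L)).
    by rewrite mulr_gt0// powR_gt0// invr_gt0.
  move=> F A H H0 mF F0 mA A0 Ai FA AH.
  (* In dimension one independence of the only coordinate means that [A ord0] is constant, so F is
     bounded by H / (2L). *)
  have Ac x : A ord0 x = A ord0 0.
    rewrite -(rV_set_id x ord0) (_ : rV_set x ord0 _ = rV_set 0 ord0 (x ord0 ord0)) ?Ai//.
    by apply/rowP => j; rewrite (ord1 j) !mxE.
  have mC : measurable (cube L : set (borel_rV R 1)) by exact: measurable_cube.
  have : (A ord0 0%R * (2 * L)%:E <= H%:E)%E.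
    apply: le_trans (AH ord0); rewrite (eq_integral (cst (A ord0 0%R))); last first.
      by move=> x _; rewrite Ac.
    by rewrite integral_cst// [X in (_ <= _ * X)%E](lebesgue_rV_cube 1 (ltW L0)) expr1.
  rewrite -lee_pdivlMr// => KH.
  have FH x : F x <= H / (2 * L) by rewrite -lee_fin; apply: le_trans (FA ord0 x) _; rewrite Ac.
  apply: (@le_trans _ _ (\int[lebesgue_rV R 1]_(x in cube L) ((H / (2 * L)) `^ (1 + 1^-1))%:E)%E).
    apply: ge0_le_integral => //.
    - by move=> x _; rewrite lee_fin powR_ge0.
    - by apply: measurable_funTS; exact: mP.
    - move=> x _; rewrite lee_fin ge0_ler_powR ?nnegrE ?addr_ge0 ?invr_ge0//.
      by rewrite divr_ge0 ?ltW.
  rewrite integral_cst// [X in (_ * X <= _)%E](lebesgue_rV_cube 1 (ltW L0)) expr1 -EFinM lee_fin.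
  rewrite powRM ?invr_ge0 ?(ltW H0) ?(ltW L20)// le_eqVlt; apply/orP; left; apply/eqP; ring.
pose b : R := n.+1%:R / n.+2%:R.
pose a : R := n.+2%:R^-1.
have ab : a + b = 1.
  by rewrite /a /b -{1}(mul1r _^-1) -mulrDl -natr1 addrC natr1 natr1 divff.
have a0 : 0 < a by rewrite /a invr_gt0.
have b0 : 0 < b by rewrite /b divr_gt0.
pose s : R := 1 + n.+1%:R^-1.
have s0 : 0 < s by rewrite /s addr_gt0// invr_gt0.
(* The weight b is chosen for this identity: the bound for a slice is then linear in [h t] below, so
   that it can be integrated over t, and the interpolated exponent is 1 + a. *)
have sb : s * b = 1.
  rewrite /s /b -[n.+2%:R]natr1.
  have : 0 < n.+1%:R :> R by [].
  by move: (n.+1%:R) => N N0; field; rewrite !gt_eqF// addr_gt0.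
pose c := 2 * ((2 * L)^-1 `^ a * C' `^ b).
have c0 : 0 < c by rewrite /c !mulr_gt0// powR_gt0// invr_gt0.
(* Integrating [h] over t gives at most H for each of the n+1 slice integrals, and 2LH for the
   constant added to them. *)
exists (c * (n.+1%:R + 2 * L)).
  by rewrite mulr_gt0// addr_gt0.
move=> F A H H0 mF F0 mA A0 Ai FA AH.
have mC m : measurable (cube L : set (borel_rV R m)) by exact: measurable_cube.
have L00 := ltW L0.
have mI : measurable (`[- L, L] : set (measurableTypeR R)) by exact: measurable_itv.
have F0e r x : (0 <= (F x `^ r)%:E)%E by rewrite lee_fin powR_ge0.
pose K0 := (\int[lebesgue_rV R n.+1]_(v in cube L) A ord0 (rV_cons (0%R : measurableTypeR R, v)))%E.
have K0E (t : measurableTypeR R) :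
   (\int[lebesgue_rV R n.+1]_(v in cube L) A ord0 (rV_cons (t, v)) = K0)%E.
  by apply: eq_integral => v _; rewrite -(Ai ord0 _ 0) rV_set0_cons.
have K0H : (K0 <= (H / (2 * L))%:E)%E.
  rewrite EFinM lee_pdivlMr//; apply: le_trans (AH ord0).
  rewrite integral_cubeS// (eq_integral (cst K0)); last by move=> t _; rewrite K0E.
  by rewrite integral_cst// [X in (_ <= _ * X)%E](lebesgue_measure_symitv L00).
(* The sum bounds all the slice integrals by one number, as the induction hypothesis requires; the
   added H makes this number positive. *)
pose h (t : measurableTypeR R) : \bar R := (\sum_(i < n.+1)
   \int[lebesgue_rV R n.+1]_(v in cube L) A (lift ord0 i) (rV_cons (t, v)) + H%:E)%E.
have mS (g : borel_rV R n.+2 -> \bar R) (t : measurableTypeR R) : measurable_fun setT g ->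
    measurable_fun setT ((fun v => g (rV_cons (t, v))) : borel_rV R n.+1 -> \bar R).
  exact: measurable_rV_slice.
have hH t : (H%:E <= h t)%E.
  by rewrite /h leeDr// sume_ge0// => i _; exact: integral_ge0.
have step (t : measurableTypeR R) :
   (\int[lebesgue_rV R n.+1]_(v in cube L) (F (rV_cons (t, v)) `^ (1 + a))%:E
      <= (c * H `^ a)%:E * h t)%E.
  have [->|htoo] := eqVneq (h t) +oo%E.
    by rewrite gt0_muley ?leey// lte_fin mulr_gt0// powR_gt0.
  have hfin : h t \is a fin_num.
    by rewrite ge0_fin_numE ?lt_neqAle ?htoo ?leey//; apply: le_trans (hH t); rewrite lee_fin ltW.
  have hf0 : 0 < fine (h t).
    by rewrite -lte_fin fineK//; apply: lt_le_trans (hH t); rewrite lte_fin.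
  have mFt : measurable_fun setT ((fun v => F (rV_cons (t, v))) : borel_rV R n.+1 -> R).
    exact: measurable_rV_slice.
  have H1 : (\int[lebesgue_rV R n.+1]_(v in cube L) (F (rV_cons (t, v)))%:E <= (H / (2 * L))%:E)%E.
    apply: le_trans K0H; rewrite -(K0E t); apply: ge0_le_integral => //.
    - by move=> x _; rewrite lee_fin.
    - by apply: measurable_funTS; apply/measurable_EFinP.
    - by apply: measurable_funTS; exact: mS.
  have H2 : (\int[lebesgue_rV R n.+1]_(v in cube L) (F (rV_cons (t, v)) `^ s)%:E
       <= (C' * fine (h t) `^ s)%:E)%E.
    apply: (IH (fun v => F (rV_cons (t, v)))
       (fun i v => A (lift ord0 i) (rV_cons (t, v)))) => //.
    - by move=> i; exact: mS.
    - by move=> i v r; rewrite -rV_setS_cons Ai.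
    - move=> i; rewrite fineK// /h (bigD1 i)//= -addeA leeDl//.
      apply: adde_ge0; last by rewrite lee_fin ltW.
      by apply: sume_ge0 => j _; exact: integral_ge0.
  have := integral_powR_interpolation_le (mC _) mFt (fun v => F0 _) a0 b0 ab s0
      (divr_gt0 H0 L20) (mulr_gt0 C'0 (powR_gt0 s hf0)) H1 H2.
  rewrite sb addrC => /le_trans; apply.
  rewrite -{2}(fineK hfin) -EFinM lee_fin /c.
  rewrite !powRM ?powR_ge0 ?invr_ge0 ?(ltW H0) ?(ltW L20) ?(ltW C'0)//.
  rewrite -powRrM sb powRr1 ?(ltW hf0)// le_eqVlt; apply/orP; left; apply/eqP; ring.
rewrite -/a integral_cubeS//; last exact: mP.
have mh : measurable_fun setT h.
  apply: emeasurable_funD => //; apply: emeasurable_sum => i.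
  exact: measurable_integral_cube_slice.
apply: (@le_trans _ _ (\int[@lebesgue_measure R]_(t in `[(- L)%R, L]) ((c * H `^ a)%:E * h t))%E).
  apply: ge0_le_integral => //.
  - by move=> t _; exact: integral_ge0.
  - apply: measurable_funTS; apply: (@measurable_integral_cube_slice _ _ _
      (fun x => (F x `^ (1 + a))%:E)) => //; exact: mP.
  - by apply: measurable_funeM; exact: measurable_funTS.
rewrite ge0_integralZl//; last 3 first.
- exact: measurable_funTS.
- by move=> t _; apply: le_trans (hH t); rewrite lee_fin ltW.
- by rewrite lee_fin mulr_ge0 ?powR_ge0 ?ltW.
have -> : c * (n.+1%:R + 2 * L) * H `^ (1 + a) = (c * H `^ a) * ((n.+1%:R + 2 * L) * H).
  rewrite powRD ?powRr1 ?ltW//; first by ring.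
  by rewrite gt_eqF// addr_gt0.
rewrite [leRHS]EFinM; apply: lee_wpmul2l.
  by rewrite lee_fin mulr_ge0 ?powR_ge0 ?(ltW c0).
rewrite /h ge0_integralD//; last 3 first.
- by move=> t _; apply: sume_ge0 => i _; exact: integral_ge0.
- apply: measurable_funTS; apply: emeasurable_sum => i.
  exact: measurable_integral_cube_slice.
- by move=> t _; rewrite lee_fin ltW.
rewrite mulrDl EFinD; apply: leeD; last first.
  by rewrite integral_cst// [X in (_ * X <= _)%E](lebesgue_measure_symitv L00) -EFinM lee_fin mulrC.
rewrite ge0_integral_sum//; last 2 first.
- by move=> i; apply: measurable_funTS; exact: measurable_integral_cube_slice.
- by move=> i t _; exact: integral_ge0.
apply: (@le_trans _ _ (\sum_(i < n.+1) H%:E)%E).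
  by apply: lee_sum => i _; rewrite -integral_cubeS.
by rewrite sumEFin sumr_const card_ord mulr_natl.
Qed.

(** * Hausdorff measure is a metric outer measure *)

Lemma normr_le_coord (R : realType) n (x : 'rV[R]_n) (c : R) :
  0 <= c -> (forall i, `|x ord0 i| <= c) -> `|x| <= c.
Proof.
move=> c0 h; rewrite [leLHS]/Num.Def.normr/= mx_normrE.
by apply: bigmax_le => // -[i j] _; rewrite (ord1 i); exact: h.
Qed.

Lemma coord_le_normr (R : realType) n (x : 'rV[R]_n) i : `|x ord0 i| <= `|x|.
Proof.
rewrite [leRHS]/Num.Def.normr/= mx_normrE.
by apply/bigmax_geP; right => /=; exists (ord0, i).
Qed.

Lemma coord_le_enorm (R : realType) n (x : 'rV[R]_n) i : `|x ord0 i| <= enorm x.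
Proof.
rewrite /enorm -sqrtr_sqr ler_wsqrtr// (bigD1 i)//= lerDl.
by apply: sumr_ge0 => j _; exact: sqr_ge0.
Qed.

Lemma normr_le_enorm (R : realType) n (x : 'rV[R]_n) : `|x| <= enorm x.
Proof.
by apply: normr_le_coord => [|i]; [exact: sqrtr_ge0|exact: coord_le_enorm].
Qed.

Lemma enorm_le_ediam (R : realType) n (A : set 'rV[R]_n) x y :
  A x -> A y -> ((enorm (x - y))%:E <= ediam A)%E.
Proof.
by move=> Ax Ay; apply: ereal_sup_ubound; right; exists x => //; exists y.
Qed.

Lemma le_hausdorff_gauge (R : realType) n s (A B : set 'rV[R]_n) :
  A `<=` B -> (hausdorff_gauge s A <= hausdorff_gauge s B)%E.
Proof.
move=> AB; rewrite {1}/hausdorff_gauge; case: ifPn => [_|A0].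
  exact: hausdorff_gauge_ge0.
rewrite /hausdorff_gauge ifF; last first.
  apply/negbTE; apply: contra A0 => /eqP B0.
  by apply/eqP; rewrite -subset0 -B0.
apply: lee_wpmul2l.
  by rewrite lee_fin divr_ge0 ?ball_volume_ge0.
elim: s => [|s IH]; first by rewrite !expe0.
rewrite !expeS; apply: lee_pmul => //; rewrite ?ediam_ge0 ?expe_ge0 ?ediam_ge0//.
exact: le_ediam.
Qed.

Definition separated_by (R : realType) n (e : R) (P Q : set 'rV[R]_n) :=
  forall x y, P x -> Q y -> e <= `|x - y|.

(** A set of Euclidean diameter at most d < e cannot meet both P and Q, since the sup norm used for
    the separation is at most the Euclidean norm. A cover of the union therefore splits into covers
    of P and of Q without any set being counted twice. *)
Lemma hausdorff_delta_separated (R : realType) n s (d e : R) (P Q : set 'rV[R]_n) :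
  d < e -> separated_by e P Q ->
  (hausdorff_delta s d P + hausdorff_delta s d Q <=
   hausdorff_delta s d (P `|` Q))%E.
Proof.
move=> de PQ; apply: le_ereal_inf_tmp => _ [F [Fd FPQ] <-].
apply: (@le_trans _ _ (\sum_(k <oo) hausdorff_gauge s (F k `&` P) +
    \sum_(k <oo) hausdorff_gauge s (F k `&` Q))%E).
  apply: leeD.
    apply: ereal_inf_lbound; exists (fun k => F k `&` P) => //; split.
      by move=> k; apply: le_trans (Fd k); apply: le_ediam; exact: subIsetl.
    by move=> x Px; have [k _ Fk] := FPQ x (or_introl Px); exists k.
  apply: ereal_inf_lbound; exists (fun k => F k `&` Q) => //; split.
    by move=> k; apply: le_trans (Fd k); apply: le_ediam; exact: subIsetl.
  by move=> x Qx; have [k _ Fk] := FPQ x (or_intror Qx); exists k.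
rewrite -nneseriesD; [|by move=> *; exact: hausdorff_gauge_ge0..].
apply: lee_nneseries => [k _ _|k _].
  by apply: adde_ge0; exact: hausdorff_gauge_ge0.
have g0 : hausdorff_gauge s (set0 : set 'rV[R]_n) = 0%E.
  by rewrite /hausdorff_gauge eqxx.
have [P0|/set0P[x [Fx Px]]] := eqVneq (F k `&` P) set0.
  by rewrite P0 g0 add0e; apply: le_hausdorff_gauge; exact: subIsetl.
have [Q0|/set0P[y [Fy Qy]]] := eqVneq (F k `&` Q) set0.
  by rewrite Q0 g0 adde0; apply: le_hausdorff_gauge; exact: subIsetl.
have := le_trans (enorm_le_ediam Fx Fy) (Fd k); rewrite lee_fin.
move=> /(le_trans (normr_le_enorm _)) /(le_trans (PQ _ _ Px Qy)).
by rewrite leNgt de.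
Qed.

Lemma le_hausdorff_delta (R : realType) n s (d d' : R) (A : set 'rV[R]_n) :
  d <= d' -> (hausdorff_delta s d' A <= hausdorff_delta s d A)%E.
Proof.
move=> dd; apply: ereal_inf_le_tmp => _ [F [Fd FA] <-].
exists F => //.
by split => // k; apply: le_trans (Fd k) _; rewrite lee_fin.
Qed.

Lemma hausdorff_separated (R : realType) n s (e : R) (P Q : set 'rV[R]_n) :
  0 < e -> separated_by e P Q ->
  (hausdorff s P + hausdorff s Q <= hausdorff s (P `|` Q))%E.
Proof.
move=> e0 PQ; set c := hausdorff s (P `|` Q).
(* The two Hausdorff measures are suprema over unrelated scales d1 and d2. A common scale below both
   and below e suffices, because [hausdorff_delta] grows as the scale shrinks. *)
have H d1 d2 : 0 < d1 -> 0 < d2 ->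
    (hausdorff_delta s d1 P + hausdorff_delta s d2 Q <= c)%E.
  move=> d10 d20; pose d := Num.min (Num.min d1 d2) (e / 2).
  have d0 : 0 < d by rewrite !lt_min d10 d20 divr_gt0.
  have de : d < e.
    by rewrite /d gt_min; apply/orP; right; rewrite ltr_pdivrMr// ltr_pMr// ltr1n.
  have dd1 : d <= d1 by rewrite !ge_min lexx.
  have dd2 : d <= d2 by rewrite !ge_min lexx orbT.
  apply: (@le_trans _ _ (hausdorff_delta s d P + hausdorff_delta s d Q)%E).
    by apply: leeD; exact: le_hausdorff_delta.
  apply: le_trans (hausdorff_delta_separated s de PQ) _.
  by apply: ereal_sup_ubound; exists d => //.
have [->|coo] := eqVneq c +oo%E; first by rewrite leey.
have d0 (A : set 'rV[R]_n) d : 0 < d -> (0 <= hausdorff_delta s d A)%E.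
  by move=> dp; have [_ [h _]] := hausdorff_delta_outer n s dp; exact: h.
have cfin : c \is a fin_num.
  rewrite ge0_fin_numE ?lt_neqAle ?coo ?leey//.
  exact: (outer_measure_ge0 (@hausdorff R n s)).
have fP d : 0 < d -> hausdorff_delta s d P \is a fin_num.
  move=> dp; rewrite ge0_fin_numE ?d0//; apply: (@le_lt_trans _ _ c).
    by apply: le_trans (H d d dp dp); rewrite leeDl// d0.
  by rewrite ltey_eq cfin.
rewrite -leeBrDr; last first.
  rewrite ge0_fin_numE; last exact: (outer_measure_ge0 (@hausdorff R n s)).
  apply: (@le_lt_trans _ _ c); last by rewrite ltey_eq cfin.
  by apply: (le_outer_measure (@hausdorff R n s)) => x; right.
apply: ge_ereal_sup => _ [d1 d10 <-].
rewrite leeBrDr; last first.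
  rewrite ge0_fin_numE; last exact: (outer_measure_ge0 (@hausdorff R n s)).
  apply: (@le_lt_trans _ _ c); last by rewrite ltey_eq cfin.
  by apply: (le_outer_measure (@hausdorff R n s)) => x; right.
rewrite addeC -leeBrDr ?fP//.
apply: ge_ereal_sup => _ [d2 d20 <-].
by rewrite leeBrDr ?fP// addeC H.
Qed.

(* Caratheodory's criterion.  With N k the points of X at distance at least
   1/(k+1) from A, the shells P k = N k.+1 \ N k satisfy
   mu (P k.+1) <= mu (N k.+2) - mu (N k), so their measures telescope. *)
Lemma closed_caratheodory (R : realType) n
    (mu : {outer_measure set 'rV[R]_n -> \bar R}) (A : set 'rV[R]_n) :
  (forall e P Q, 0 < e -> separated_by e P Q -> (mu P + mu Q <= mu (P `|` Q))%E) ->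
  closed A -> mu.-caratheodory A.
Proof.
move=> sep cA; apply: le_caratheodory_measurable => X.
have [->|Xoo] := eqVneq (mu X) +oo%E; first by rewrite leey.
have Xlt : (mu X < +oo)%E by rewrite lt_neqAle Xoo leey.
pose N k := [set x | X x /\ forall a, A a -> k.+1%:R^-1 <= `|x - a|].
pose P k := N k.+1 `\` N k.
have NX k : N k `<=` X by move=> x [].
have muX B : B `<=` X -> mu B \is a fin_num.
  move=> BX; rewrite ge0_fin_numE ?outer_measure_ge0//.
  by apply: le_lt_trans Xlt; exact: le_outer_measure.
have NN k : N k `<=` N k.+1.
  move=> x [Xx h]; split => // a Aa; apply: le_trans (h a Aa).
  by rewrite lef_pV2 ?posrE// ler_nat.
have PX k : P k `<=` X by move=> x [/NX].
have tel k : (mu (P k.+1) + mu (N k) <= mu (N k.+2))%E.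
  rewrite addeC; apply: (@le_trans _ _ (mu (N k `|` P k.+1))).
    apply: (sep (k.+1%:R^-1 - k.+2%:R^-1)).
      by rewrite subr_gt0 ltf_pV2 ?posrE// ltr_nat.
    move=> x y [Xx hx] [[Xy _] hy].
    have [a Aa ya] : exists2 a, A a & `|y - a| < k.+2%:R^-1.
      apply: contrapT => h; apply: hy; split => // a Aa; rewrite leNgt.
      by apply/negP => ya; apply: h; exists a.
    rewrite lerBlDr; apply: le_trans (hx a Aa) _.
    rewrite -(subrKA y x); apply: le_trans (ler_normD _ _) _.
    by rewrite lerD2l ltW.
  by apply: le_outer_measure => x [/NN/NN//|[]].
(* Each increment spans two indices, so the telescoping sum keeps two consecutive terms at either
   end. *)
have sumP k J : (\sum_(j < J) mu (P (k + j).+1) + (mu (N k) + mu (N k.+1)) <=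
    mu (N (k + J)%N) + mu (N (k + J).+1))%E.
  elim: J => [|J IH]; first by rewrite big_ord0 add0e addn0.
  rewrite big_ord_recr/= addeAC addnS.
  apply: (le_trans (leeD2r _ IH)).
  by rewrite addeAC addeC leeD2l// addeC; exact: tel.
(* As A is closed, a point outside A has positive distance from A and lies in some [N m]; the least
   such m tells which shell contains it. *)
have cov k : X `&` ~` A `<=` N k.+1 `|` \bigcup_j P (k + j).+1.
  move=> x [Xx nAx].
  have [m hm] : exists m, N m x.
    have : nbhs x (~` A) by apply: open_nbhs_nbhs; split => //; exact: closed_openC.
    move=> /nbhs_ballP[e /= e0 eA].
    have [m me] : exists m : nat, m.+1%:R^-1 < e.
      have [m _ hm] := near_infty_natSinv_lt (PosNum e0).
      by exists m; exact: (hm m (leqnn m)).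
    exists m; split => // a Aa; rewrite leNgt; apply/negP => xa.
    by apply: (eA a) => //; rewrite -ball_normE /ball_/=; apply: lt_trans me.
  have ex : exists m, `[< N m x >] by exists m; apply/asboolP.
  case: (ex_minnP ex) => m0 /asboolP Nm0 min.
  have [m0k|km0] := leqP m0 k.+1.
    left; have : forall i, N (m0 + i)%N x.
      by elim => [|i IH]; rewrite ?addn0// addnS; exact: NN.
    by move/(_ (k.+1 - m0)%N); rewrite subnKC.
  right; exists (m0 - k.+2)%N => //; rewrite -addSn.
  have -> : (k.+1 + (m0 - k.+2) = m0.-1)%N by lia.
  split; first by rewrite prednK// (leq_ltn_trans _ km0).
  by move=> /asboolP /min; rewrite leqNgt prednK ?leqnn// (leq_ltn_trans _ km0).
pose a k := fine (mu (N k)).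
have aE k : mu (N k) = (a k)%:E by rewrite /a fineK// muX.
pose M := fine (mu X - mu (X `&` A)).
have XAfin : mu (X `&` A) \is a fin_num by apply: muX; exact: subIsetl.
have MX : (mu X - mu (X `&` A))%E = M%:E by rewrite /M fineK// fin_numB muX.
have aM k : a k <= M.
  rewrite -lee_fin -aE -MX leeBrDr//.
  apply: (@le_trans _ _ (mu (N k `|` (X `&` A)))).
    apply: (sep k.+1%:R^-1); first by rewrite invr_gt0.
    by move=> x y [_ h] [_ Ay]; exact: h.
  by apply: le_outer_measure => x [/NX|[]].
have supa : has_sup (range a).
  by split; [exists (a 0); exists 0%N|exists M => _ [k _ <-]].
pose l := sup (range a).
have al k : a k <= l by apply: sup_upper_bound => //; exists k.
rewrite addeC -leeBrDr// MX.
suff : (mu (X `&` ~` A) <= l%:E)%E.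
  move=> /le_trans; apply; rewrite lee_fin; apply: sup_le_ub.
    by exists (a 0); exists 0%N.
  by move=> _ [k _ <-].
apply/lee_addgt0Pr => e e0.
have e20 : 0 < e / 2 by rewrite divr_gt0.
(* With [a k] within e/2 of the supremum, all shells beyond k have total measure at most 2 (l - a k)
   < e. *)
have [_ [k _ <-] ak] := sup_adherent e20 supa; rewrite -/l in ak.
apply: le_trans (le_outer_measure mu _ _ (cov k)) _.
apply: le_trans (outer_measureU2 _ _ _) _.
apply: leeD; first by rewrite aE lee_fin.
apply: le_trans (outer_measure_sigma_subadditive mu _) _.
apply: lime_le.
  by apply: is_cvg_nneseries => *; exact: outer_measure_ge0.
apply: nearW => J /=; rewrite big_mkord.
have := sumP k J; rewrite !aE -!EFinD -leeBrDr//= -EFinB => /le_trans; apply.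
rewrite lee_fin; have := al (k + J)%N; have := al (k + J).+1.
have : a k <= a k.+1 by rewrite -lee_fin -!aE; exact: le_outer_measure.
move: ak; lra.
Qed.

Lemma closed_hausdorff_measurable (R : realType) n s (A : set 'rV[R]_n) :
  closed A -> (@hausdorff R n s).-caratheodory A.
Proof.
apply: closed_caratheodory => e P Q e0 PQ.
exact: hausdorff_separated PQ.
Qed.

(** * Projections of Hausdorff measure *)

Lemma ball_volume_gt0 (R : realType) s : 0 < ball_volume R s.
Proof.
suff : 0 < ball_volume R s /\ 0 < ball_volume R s.+1 by case.
elim: s => [|s [s0 s1]] //=; split=> //.
by rewrite mulr_gt0// divr_gt0// mulr_gt0// pi_gt0.
Qed.

(** A nearly optimal cover of E is thickened: each of its sets lies in a cylinder in the direction i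
    around one of its points, with its diameter as radius. The union W is a measurable stand-in for
    the cylinder over E, and e pays for the infimum not being attained. *)
Lemma hausdorff_cylinder_cover (R : realType) n (L : R) : 0 < L ->
  exists2 C : R, 0 < C &
  forall (E : set 'rV[R]_n.+1) (i : 'I_n.+1) (e : R), 0 < e ->
  exists W : set (borel_rV R n.+1),
  [/\ measurable W, forall x t, W x -> W (rV_set x i t),
      forall b t, E b -> W (rV_set b i t) &
      (lebesgue_rV R n.+1 (W `&` cube L) <= C%:E * (hausdorff n E + e%:E))%E].
Proof.
move=> L0; have bv0 := ball_volume_gt0 R n.
have c20 : 0 < ball_volume R n / 2 ^+ n by rewrite divr_gt0 ?exprn_gt0.
(* Inside the cube a cylinder of radius d lies in a box of volume 2L (2d)^n; C is the ratio of this
   volume to the gauge of a set of diameter d. *)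
pose C := 2 * L * 2 ^+ n / (ball_volume R n / 2 ^+ n).
have C0 : 0 < C by rewrite divr_gt0// !mulr_gt0// exprn_gt0.
exists C => // E i e e0.
have H0 : (0 <= hausdorff n E)%E by exact: (outer_measure_ge0 (@hausdorff R n.+1 n)).
have [HE|HE] := eqVneq (hausdorff n E) +oo%E.
  exists setT; split => //; rewrite HE addye// gt0_muley ?leey//.
have Hfin : hausdorff n E \is a fin_num by rewrite ge0_fin_numE ?lt_neqAle ?HE ?leey.
(* Any fixed scale would do: it only has to make the covering sets of finite diameter. *)
have Hd : (hausdorff_delta n 1 E <= hausdorff n E)%E.
  by apply: ereal_sup_ubound; exists 1%R => /=.
have : (hausdorff_delta n 1 E < hausdorff n E + e%:E)%E.
  by apply: le_lt_trans Hd _; rewrite lteDl// lte_fin.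
move=> /ereal_inf_lt[_ [F [Fd FE] <-] Flt].
pose cyl (a : 'rV[R]_n.+1) (d : R) : set (borel_rV R n.+1) :=
  [set x | forall j, j != i -> `|(x : 'rV[R]_n.+1) ord0 j - a ord0 j| <= d].
have mcyl a d : measurable (cyl a d).
  rewrite (_ : cyl a d = \bigcap_(j in [set j | j != i])
      [set x : 'rV[R]_n.+1 | `|x ord0 j - a ord0 j| <= d]) //.
  apply: fin_bigcap_measurable => [|j _]; last exact: measurable_norm_coord.
  exact: finite_finset.
have /choice[B hB] : forall k, exists B : set (borel_rV R n.+1),
   [/\ measurable B, forall x t, B x -> B (rV_set x i t),
      forall b t, F k b -> B (rV_set b i t) &
      (lebesgue_rV R n.+1 (B `&` cube L) <= C%:E * hausdorff_gauge n (F k))%E].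
  move=> k; have [F0|/set0P[a Fa]] := eqVneq (F k) set0.
    exists set0; split => //; first by rewrite F0.
    by rewrite set0I measure0 mule_ge0 ?lee_fin ?(ltW C0) ?hausdorff_gauge_ge0.
  have dfin : ediam (F k) \is a fin_num.
    rewrite ge0_fin_numE ?ediam_ge0//; apply: le_lt_trans (Fd k) _; exact: ltry.
  set d := fine (ediam (F k)).
  have dE : ediam (F k) = d%:E by rewrite /d fineK.
  have d0 : 0 <= d by rewrite -lee_fin -dE ediam_ge0.
  exists (cyl a d); split => //.
  - by move=> x t h j ji; rewrite mxE (negbTE ji); exact: h.
  - move=> b t Fb j ji; rewrite mxE (negbTE ji).
    have := coord_le_enorm (b - a) j; rewrite !mxE => /le_trans; apply.
    by rewrite -lee_fin -dE; exact: enorm_le_ediam.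
  (* The cylinder is cut by the cube in the direction i only, so the i-th side of the box is centred
     at 0 with half-length L. *)
  apply: (@le_trans _ _ (lebesgue_rV R n.+1 [set x : 'rV[R]_n.+1 | forall j,
      `|x ord0 j - rV_set a i 0 ord0 j| <= if j == i then L else d])).
    apply: le_measure; rewrite ?inE.
    - by apply: measurableI => //; exact: measurable_cube.
    - rewrite (_ : mkset _ = \bigcap_j [set x : 'rV[R]_n.+1 |
         `|x ord0 j - rV_set a i 0 ord0 j| <= if j == i then L else d]).
        by apply: fin_bigcap_measurable => // j _; exact: measurable_norm_coord.
      by apply/seteqP; split => [x h j _|x h j]; [exact: h|exact: (h j I)].
    - move=> x [h1 h2] j /=; rewrite mxE; case: eqP => [_|/eqP ji].
        by rewrite subr0; exact: h2.
      exact: h1.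
  rewrite lebesgue_rV_box; last by move=> j; case: ifP => // _; exact: ltW.
  rewrite (bigD1 i)//= eqxx.
  rewrite (eq_bigr (fun=> 2 * d)); last by move=> j /negbTE ->.
  rewrite prodr_const cardC1 card_ord /= /hausdorff_gauge ifF; last first.
    by apply/negbTE/set0P; exists a.
  rewrite dE -EFin_expe -!EFinM lee_fin /C mulrA divfK ?gt_eqF//.
  by rewrite exprMn -!mulrA.
exists (\bigcup_k B k); split.
- by apply: bigcup_measurable => k _; have [] := hB k.
- by move=> x t [k _ Bx]; exists k => //; have [_ h _ _] := hB k; exact: h.
- move=> b t Eb; have [k _ Fb] := FE b Eb.
  by exists k => //; have [_ _ h _] := hB k; exact: h.
rewrite setI_bigcupl; apply: (@le_trans _ _
   (\sum_(k <oo) lebesgue_rV R n.+1 (B k `&` cube L))%E).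
  apply: generalized_Boole_inequality.
    by move=> k; apply: measurableI; [have [] := hB k|exact: measurable_cube].
  apply: bigcup_measurable => k _.
  by apply: measurableI; [have [] := hB k|exact: measurable_cube].
apply: (@le_trans _ _ (\sum_(k <oo) (C%:E * hausdorff_gauge n (F k)))%E).
  by apply: lee_nneseries => [k _ _|k _]; [exact: measure_ge0|have [] := hB k].
rewrite nneseriesZl; last by move=> k _; exact: hausdorff_gauge_ge0.
by apply: lee_wpmul2l; [rewrite lee_fin ltW|exact: ltW].
Qed.

Lemma sum_measure_le_integral (R : realType) d (T : measurableType d)
    (mu : {measure set T -> \bar R}) N (E : 'I_N -> set T) (f : T -> R) :
  (forall k, measurable (E k)) -> measurable_fun setT f -> (forall x, 0 <= f x) ->
  (forall x, \sum_(k < N) \1_(E k) x <= f x) ->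
  (\sum_(k < N) mu (E k) <= \int[mu]_x (f x)%:E)%E.
Proof.
move=> mE mf f0 Ef.
apply: (@le_trans _ _ (\int[mu]_x (\sum_(k < N) (\1_(E k) x)%:E))%E); last first.
  apply: ge0_le_integral => //.
  - by move=> x _; exact: sume_ge0.
  - by apply: emeasurable_sum => k; exact/measurable_EFinP/measurable_indic.
  - exact/measurable_EFinP.
  - by move=> x _; rewrite sumEFin lee_fin.
rewrite ge0_integral_sum//.
  by apply: lee_sum => k _; rewrite integral_indic// setIT.
by move=> k; exact/measurable_EFinP/measurable_indic.
Qed.

(** The sum counts the positive integers up to M that do not exceed y, so it is the integer part of
    y capped at M. This is a discrete layer-cake formula with finitely many levels. *)
Lemma sum_levels_bounds (R : realType) (M : nat) (y : R) : 0 <= y ->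
  \sum_(k < M) (k.+1%:R <= y)%R%:R <= y /\
  (y <= M%:R -> y <= 1 + \sum_(k < M) (k.+1%:R <= y)%R%:R).
Proof.
move=> y0.
suff [h1 h2] : (M%:R <= y -> \sum_(k < M) (k.+1%:R <= y)%R%:R = M%:R :> R) /\
    (y < M%:R -> \sum_(k < M) (k.+1%:R <= y)%R%:R <= y <=
                 1 + \sum_(k < M) (k.+1%:R <= y)%R%:R).
  case: (leP M%:R y) => [My|yM]; last by have /andP[] := h2 yM.
  by rewrite h1//; split => // yM; apply: le_trans yM _; rewrite lerDr.
elim: M => [|M [IH1 IH2]].
  by rewrite big_ord0; split => //; rewrite ltNge y0.
rewrite big_ord_recr /=; split.
  move=> My; rewrite My IH1 ?natr1//.
  by apply: le_trans My; rewrite ler_nat.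
move=> yM; have -> : (M.+1%:R <= y) = false by rewrite leNgt yM.
rewrite addr0.
case: (leP M%:R y) => [My|yM']; last exact: IH2.
by rewrite IH1// My /= addrC natr1 ltW.
Qed.

(** Extension by zero leaves the superlevel sets with c > 0 unchanged, hence closed and Caratheodory
    measurable; for c <= 0 they are the whole space. *)
Lemma measurable_restrict_closed_levels (R : realType) n s (B : set 'rV[R]_n)
    (w : 'rV[R]_n -> R) :
  (forall x, 0 <= w x) -> (forall c, closed (B `&` [set x | c <= w x])) ->
  measurable_fun setT ((w \_ B) : caratheodory_type (@hausdorff R n s) -> R).
Proof.
move=> w0 cw; apply: (measurability _ (RGenCInfty.measurableE R)) => _ [_ [c ->] <-].
rewrite setTI; have [c0|c0] := leP c 0.
  rewrite (_ : _ @^-1` _ = setT) //; apply/seteqP; split => // x _ /=.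
  rewrite in_itv/= andbT patchE; case: ifP => _ //.
  exact: le_trans c0 (w0 x).
rewrite (_ : _ @^-1` _ = B `&` [set x | c <= w x]).
  exact: closed_hausdorff_measurable.
apply/seteqP; split => x /=; rewrite in_itv/= andbT patchE.
  by case: ifPn; rewrite ?inE//= leNgt c0.
by move=> [Bx cx]; rewrite mem_set.
Qed.

(* For n.+1 = 1 the measure [hausdorff 0] counts points and the cylinder over a
   point is the whole line. *)
Lemma hausdorff_projection (R : realType) n (L : R) : 0 < L ->
  exists2 C : R, 0 < C &
  forall (B : set 'rV[R]_n.+1) (w : 'rV[R]_n.+1 -> R) (M : R) (i : 'I_n.+1),
  (forall x, 0 <= w x) -> (forall x, B x -> w x <= M) ->
  (forall c, closed (B `&` [set x | c <= w x])) ->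
  exists G : borel_rV R n.+1 -> \bar R,
  [/\ measurable_fun setT G, (forall x, 0 <= G x)%E,
      forall x t, G (rV_set x i t) = G x,
      (forall b t, B b -> (w b)%:E <= G (rV_set b i t))%E &
      (\int[lebesgue_rV R n.+1]_(x in cube L) G x <=
        C%:E * (\int[caratheodory_measure (@hausdorff R n.+1 n)]_x (w \_ B x)%:E + 1))%E].
Proof.
move=> L0; have [C C0 HC] := @hausdorff_cylinder_cover R n L L0.
pose V := (2 * L) ^+ n.+1.
have V0 : 0 < V by rewrite exprn_gt0// mulr_gt0.
exists (C + V); first by rewrite addr_gt0.
move=> B w M i w0 wM cw.
set hm := caratheodory_measure (@hausdorff R n.+1 n).
have mE c : measurable ((B `&` [set x | c <= w x]) : set (caratheodory_type (@hausdorff R n.+1 n))).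
  exact: closed_hausdorff_measurable.
have [N [N0 MN]] : exists N : nat, (0 < N)%N /\ M <= N%:R.
  exists (Num.truncn M).+1; split => //; exact/ltW/truncnS_gt.
pose E k := B `&` [set x | k.+1%:R <= w x].
have e0 : 0 < N%:R^-1 :> R by rewrite invr_gt0 ltr0n.
(* Each of the N superlevel sets is covered with error 1/N, so that the errors add up to the single
   1 in the bound. *)
have /choice[W hW] : forall k : nat, exists W : set (borel_rV R n.+1),
  [/\ measurable W, forall x t, W x -> W (rV_set x i t),
      forall b t, E k b -> W (rV_set b i t) &
      (lebesgue_rV R n.+1 (W `&` cube L) <= C%:E * (hausdorff n (E k) + (N%:R^-1)%:E))%E].
  by move=> k; exact: HC.
have WE k x t : W k (rV_set x i t) <-> W k x.
  have [_ h _ _] := hW k; split => [/(h _ (x ord0 i))|]; last exact: h.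
  by rewrite rV_set_set rV_set_id.
(* The sum recovers the integer part of w at any point of B on the line; the leading 1 makes up for
   the rounding and costs the volume V of the cube. *)
pose G x : R := 1 + \sum_(k < N) \1_(W k) x.
have mW k : measurable (W k) by have [] := hW k.
exists (EFin \o G); split.
- apply/measurable_EFinP; apply: measurable_funD => //.
  by apply: measurable_sum => k; exact: measurable_indic.
- by move=> x; rewrite lee_fin addr_ge0// sumr_ge0.
- move=> x t; rewrite /= /G; congr (_ + _)%:E; apply: eq_bigr => k _.
  rewrite !indicE; congr (_ %:R); congr nat_of_bool.
  by apply/idP/idP; rewrite !inE => /WE.
- move=> b t Bb; rewrite lee_fin.
  have [_ /(_ (le_trans (wM b Bb) MN))/le_trans] := sum_levels_bounds N (w0 b); apply.
  rewrite lerD2l; apply: ler_sum => k _; rewrite indicE.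
  case: (boolP (_ <= w b)) => // kw; rewrite mem_set//.
  by have [_ _ h _] := hW k; apply: h.
have mC : measurable (cube L : set (borel_rV R n.+1)) by exact: measurable_cube.
rewrite (eq_integral (fun x => 1%:E + \sum_(k < N) (\1_(W k) x)%:E)%E); last first.
  by move=> x _; rewrite /= /G EFinD sumEFin.
have mi k : measurable_fun (cube L : set (borel_rV R n.+1)) (fun x => (\1_(W k) x)%:E : \bar R).
  by apply/measurable_EFinP; exact: measurable_indic.
rewrite ge0_integralD//; last 2 first.
- by move=> x _; exact: sume_ge0.
- exact: emeasurable_sum.
rewrite integral_cst// [X in (_ * X + _)%E](lebesgue_rV_cube n.+1 (ltW L0)) -/V mul1e.
rewrite ge0_integral_sum//.
have Ew : (\sum_(k < N) hm (E k) <= \int[hm]_x (w \_ B x)%:E)%E.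
  apply: (@sum_measure_le_integral R _ _ hm N (fun k => E k) (w \_ B)) => [k||x|x].
  - exact: mE.
  - exact: measurable_restrict_closed_levels.
  - by rewrite patchE; case: ifP.
  rewrite patchE; case: ifPn; rewrite ?notin_setE ?inE => Bx.
    apply: le_trans (sum_levels_bounds N (w0 x)).1.
    apply: ler_sum => k _; rewrite indicE ler_nat.
    by case: (boolP (_ \in _)) => //; rewrite inE => -[_ /= ->].
  rewrite big1// => k _; rewrite indicE memNset//.
  by case.
have Gsum : (\sum_(k < N) \int[lebesgue_rV R n.+1]_(x in cube L) (\1_(W k) x)%:E <=
    C%:E * (\int[hm]_x (w \_ B x)%:E + 1))%E.
  apply: (@le_trans _ _ (\sum_(k < N) (C%:E * (hm (E k) + (N%:R^-1)%:E)))%E).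
    apply: lee_sum => k _; rewrite integral_indic//.
    by have [] := hW k.
  rewrite -ge0_sume_distrr; last first.
    by move=> k _; rewrite adde_ge0 ?lee_fin ?(ltW e0).
  apply: lee_wpmul2l; first by rewrite lee_fin ltW.
  rewrite big_split/=; apply: leeD => //.
  by rewrite sumEFin sumr_const card_ord -[_ *+ N]mulr_natr mulVf// gt_eqF// ltr0n.
have I0 : (0 <= \int[hm]_x (w \_ B x)%:E)%E.
  by apply: integral_ge0 => x _; rewrite lee_fin patchE; case: ifP.
apply: (le_trans (leeD2l _ Gsum)).
rewrite EFinD ge0_muleDl ?lee_fin ?(ltW C0) ?(ltW V0)// [leRHS]addeC; apply: leeD => //.
by rewrite -{1}(mule1 V%:E); apply: lee_wpmul2l; [rewrite lee_fin ltW|rewrite leeDr].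
Qed.

(** * Functions with continuous partial derivatives *)

Lemma continuous_at_powR_gt0 (R : realType) (T : topologicalType) (g : T -> R) (r : R) x :
  0 < g x -> {for x, continuous g} -> {for x, continuous (fun y => g y `^ r)}.
Proof.
move=> gx cg.
apply: (@continuous_comp _ _ _ g (fun a : R => a `^ r)) => //.
apply: differentiable_continuous; apply/derivable1_diffP.
by apply: derivable_powR; rewrite in_itv/= gx.
Qed.

(** At a zero of g the power need not be differentiable, so continuity is checked there by hand: g <
    e^(1/r) forces g^r < e. *)
Lemma continuous_at_powR (R : realType) (T : topologicalType) (g : T -> R) (r : R) x :
  0 < r -> (forall y, 0 <= g y) -> {for x, continuous g} ->
  {for x, continuous (fun y => g y `^ r)}.
Proof.
move=> r0 g0 cg; have := g0 x; rewrite le_eqVlt => /orP[/eqP gx|gx]; last first.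
  exact: continuous_at_powR_gt0.
rewrite /prop_for /continuous_at -gx powR0 ?gt_eqF//.
apply/cvgrPdist_lt => e e0.
move/cvgrPdist_lt : cg => /(_ (e `^ r^-1)); rewrite powR_gt0// => /(_ isT).
apply: filterS => y; rewrite -gx !sub0r !normrN ger0_norm// ger0_norm ?powR_ge0// => h.
have := @gt0_ltr_powR R r r0 (g y) (e `^ r^-1).
rewrite !nnegrE powR_ge0 g0 => /(_ isT isT h).
by rewrite -powRrM mulVf ?gt_eqF// powRr1// ltW.
Qed.

Lemma continuous_at_mulr (R : realType) (T : topologicalType) (g : T -> R) (c : R) x :
  {for x, continuous g} -> {for x, continuous (fun y => g y * c)}.
Proof. by move=> cg; apply: cvgM; [exact: cg|exact: cvg_cst]. Qed.

Lemma continuous_at_sqr (R : realType) (T : topologicalType) (g : T -> R) x :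
  {for x, continuous g} -> {for x, continuous (fun y => g y ^+ 2)}.
Proof. by move=> cg; exact: (cvgM cg cg). Qed.

Lemma continuous_at_sum (R : realType) (T : topologicalType) n (h : 'I_n -> T -> R) x :
  (forall j, {for x, continuous (h j)}) ->
  {for x, continuous (fun y => \sum_j h j y)}.
Proof.
move=> ch; rewrite /prop_for /continuous_at.
by apply: cvg_big => [|j _]; [exact: add_continuous|exact: ch].
Qed.

Lemma is_derive_rV_set (R : realType) n (g : 'rV[R]_n -> R) (x : 'rV[R]_n) i t :
  derivable (g : _ -> R^o) (rV_set x i t) (delta_mx ord0 i) ->
  is_derive t 1 ((fun s => g (rV_set x i s)) : R -> R) (partial i g (rV_set x i t)).
Proof.
have E : (fun h : R => h^-1 *: (((fun s => g (rV_set x i s)) \o shift t) (h *: (1 : R))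
       - g (rV_set x i t))) =
    (fun h : R => h^-1 *: (((g : _ -> R^o) \o shift (rV_set x i t)) (h *: delta_mx ord0 i)
       - (g (rV_set x i t) : R^o))).
  apply/funext => h; congr (_ *: (g _ - _)) => /=.
  apply/rowP => j; rewrite !mxE eqxx /=; case: eqP => _.
    by rewrite mulr1 /GRing.scale/= mulr1.
  by rewrite mulr0 add0r.
move=> dg; split; first by move: dg; rewrite /derivable E.
by rewrite /partial /derive E.
Qed.

Lemma continuous_rV_set (R : realType) n (x : 'rV[R]_n) i :
  continuous (rV_set x i : R -> 'rV[R]_n).
Proof.
move=> t; apply/cvgrPdist_le => e e0; near=> s.
apply: normr_le_coord; first exact: ltW.
move=> j; rewrite !mxE; case: eqP => _; last by rewrite subrr normr0 ltW.
near: s; move: e e0; apply/cvgrPdist_le; exact: cvg_id.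
Unshelve. all: by end_near. Qed.

(** [C1_on] only provides partial derivatives. They are bounded near x by continuity, and the mean
    value theorem applied to one coordinate at a time makes the increments of g from x at most a
    constant times the distance. *)
Lemma C1_on_continuous (R : realType) n (U : set 'rV[R]_n) (g : 'rV[R]_n -> R) x :
  open U -> C1_on U g -> U x -> {for x, continuous g}.
Proof.
move=> oU gC1 Ux.
have near_bd (j : 'I_n) : \forall y \near x, `|partial j g y| <= `|partial j g x| + 1.
  have [_ cj] := gC1 x j Ux.
  move/cvgrPdist_le : cj => /(_ 1 ltr01); apply: filterS => y h.
  rewrite -[leLHS]normrN -lerBlDl; apply: le_trans h.
  rewrite normrN; apply: le_trans (lerB_dist _ _) _.
  by rewrite distrC.
pose M := \sum_j (`|partial j g x| + 1).
have M0 : 0 <= M by apply: sumr_ge0 => j _; rewrite addr_ge0.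
have : \forall y \near x, U y /\ forall j, `|partial j g y| <= M.
  apply: filterI; first by apply: open_nbhs_nbhs.
  apply: (@filter_forall _ _ (fun j y => `|partial j g y| <= M) (nbhs x)
    (nbhs_filter x)) => j.
  move: (near_bd j); apply: filterS => y /le_trans; apply.
  by rewrite /M (bigD1 j)//= lerDl; apply: sumr_ge0 => k _; rewrite addr_ge0.
move=> /nbhs_ballP[e /= e0 eU].
have lip y : ball x e y -> `|g x - g y| <= n%:R * M * `|x - y|.
  move=> xy.
  (* A path from x to y that changes one coordinate per step and stays within distance |x - y| of
     x. *)
  pose z k : 'rV[R]_n := \row_j if (j < k)%N then y ord0 j else x ord0 j.
  have z0 : z 0%N = x by apply/rowP => j; rewrite mxE.
  have zn : z n = y by apply/rowP => j; rewrite mxE ltn_ord.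
  have zE (k : 'I_n) : z k.+1 = rV_set (z k) k (y ord0 k) /\ z k = rV_set (z k) k (x ord0 k).
    split; apply/rowP => j; rewrite !mxE; case: eqP => [->|/eqP jk] //.
    - by rewrite ltnS leqnn.
    - by rewrite ltnS leq_eqVlt (inj_eq val_inj) (negbTE jk).
    - by rewrite ltnn.
  have zball (k : 'I_n) (t : R) : `|x ord0 k - t| <= `|x - y| -> ball x e (rV_set (z k) k t).
    move=> kt; rewrite -ball_normE /ball_/=.
    apply: (@le_lt_trans _ _ `|x - y|); last by move: xy; rewrite -ball_normE.
    apply: normr_le_coord => // j; rewrite !mxE; case: eqP => [->//|_].
    case: ifP => _; last by rewrite subrr normr0.
    by have := coord_le_normr (x - y) j; rewrite !mxE.
  have step (k : 'I_n) : `|g (z k) - g (z k.+1)| <= M * `|x - y|.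
    have [-> zk] := zE k; rewrite {1}zk.
    have dk t : `|x ord0 k - t| <= `|x - y| ->
        is_derive t 1 ((fun s => g (rV_set (z k) k s)) : R -> R) (partial k g (rV_set (z k) k t)).
      move=> /zball/eU[Uz _]; apply: is_derive_rV_set; by have [] := gC1 _ k Uz.
    have bk t : `|x ord0 k - t| <= `|x - y| -> `|partial k g (rV_set (z k) k t)| <= M.
      by move=> /zball/eU[_]; exact.
    have xyk : `|x ord0 k - y ord0 k| <= `|x - y|.
      by have := coord_le_normr (x - y) k; rewrite !mxE.
    have mvt a b : a <= b -> (forall t, t \in `[a, b] -> `|x ord0 k - t| <= `|x - y|) ->
        b - a <= `|x - y| ->
        `|g (rV_set (z k) k a) - g (rV_set (z k) k b)| <= M * `|x - y|.
      move=> ab hab bax.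
      have [|| c cab] := @MVT_segment R (fun s => g (rV_set (z k) k s))
         (fun t => partial k g (rV_set (z k) k t)) a b ab.
      - move=> t tab; apply: dk; apply: hab; exact: subset_itv_oo_cc.
      - apply: derivable_within_continuous => t tab.
        by have [] := dk t (hab t tab).
      rewrite distrC => ->; rewrite normrM ler_pM//; first by apply: bk; exact: hab.
      by rewrite ger0_norm// subr_ge0.
    case: (leP (x ord0 k) (y ord0 k)) => [xy'|/ltW xy'].
      apply: mvt => //.
        move=> t; rewrite in_itv/= => /andP[t1 t2]; apply: le_trans xyk.
        rewrite ler0_norm ?subr_le0// ler0_norm ?subr_le0//; lra.
      by rewrite -[leLHS]ger0_norm ?subr_ge0// distrC.
    rewrite distrC; apply: mvt => //.
      move=> t; rewrite in_itv/= => /andP[t1 t2]; apply: le_trans xyk.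
      rewrite ger0_norm ?subr_ge0// ger0_norm ?subr_ge0//; lra.
    by rewrite -[leLHS]ger0_norm ?subr_ge0.
  have : forall k, (k <= n)%N -> `|g x - g (z k)| <= k%:R * (M * `|x - y|).
    elim => [|k IH] kn; first by rewrite z0 subrr normr0 mul0r.
    rewrite -(subrKA (g (z k))); apply: le_trans (ler_normD _ _) _.
    rewrite -natr1 mulrDl mul1r; apply: lerD; first by apply: IH; exact: ltnW.
    exact: (step (Ordinal kn)).
  by move=> /(_ n (leqnn n)); rewrite zn mulrA.
apply/(@cvgrPdist_le _ _ _ _ (nbhs_filter x)) => d d0.
have K0 : 0 < n%:R * M + 1 by rewrite ltr_wpDl// mulr_ge0.
apply/nbhs_ballP; exists (Num.min e (d / (n%:R * M + 1))) => /=.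
  by rewrite lt_min e0 divr_gt0.
move=> y; rewrite -ball_normE /ball_/= lt_min => /andP[xye xyd].
apply: le_trans (lip y _) _; first by rewrite -ball_normE.
apply: (@le_trans _ _ ((n%:R * M + 1) * `|x - y|)).
  by rewrite ler_wpM2r// lerDl.
by rewrite mulrC -ler_pdivlMr// ltW.
Qed.

(** * The fundamental theorem of calculus along lines *)

Lemma cauchy_schwarz2 (R : rcfType) (a b c d : R) :
  `|a * b + c * d| <= Num.sqrt (a ^+ 2 + c ^+ 2) * Num.sqrt (b ^+ 2 + d ^+ 2).
Proof.
rewrite -sqrtrM ?addr_ge0 ?sqr_ge0// -sqrtr_sqr ler_wsqrtr//.
have := sqr_ge0 (a * d - c * b); nra.
Qed.

Lemma measurable_fun_itv_continuous (R : realType) (c d : R) (g : R -> R) :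
  (forall t, t \in `[c, d] -> {for t, continuous g}) ->
  measurable_fun (`[c, d] : set (measurableTypeR R)) (g : measurableTypeR R -> R).
Proof.
move=> cg; apply: subspace_continuous_measurable_fun; first exact: measurable_itv.
by apply: continuous_in_subspaceT => t; rewrite inE; exact: cg.
Qed.

(** For f = a + ib, |f|^s is the power s/2 of a^2 + b^2, which is differentiable where f does not
    vanish; by Cauchy-Schwarz its derivative is at most s |f|^(s-1) |f'| in modulus. *)
Lemma powR_FTC_le (R : realType) (a b a' b' G : R -> R) (c d s : R) :
  c < d -> 1 <= s ->
  (forall t, t \in `[c, d] -> is_derive t 1 (a : R -> R) (a' t)) ->
  (forall t, t \in `[c, d] -> is_derive t 1 (b : R -> R) (b' t)) ->
  (forall t, t \in `[c, d] -> {for t, continuous a'}) ->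
  (forall t, t \in `[c, d] -> {for t, continuous b'}) ->
  (forall t, t \in `[c, d] -> 0 < a t ^+ 2 + b t ^+ 2) ->
  measurable_fun (`[c, d] : set (measurableTypeR R)) (G : measurableTypeR R -> R) ->
  (forall t, t \in `[c, d] -> s * (Num.sqrt (a t ^+ 2 + b t ^+ 2) `^ (s - 1) *
           Num.sqrt (a' t ^+ 2 + b' t ^+ 2)) <= G t) ->
  ((Num.sqrt (a c ^+ 2 + b c ^+ 2) `^ s)%:E <=
   (Num.sqrt (a d ^+ 2 + b d ^+ 2) `^ s)%:E +
   \int[@lebesgue_measure R]_(t in `[c, d]) (G t)%:E)%E.
Proof.
move=> cd s1 da db ca' cb' w0 mG hG.
pose w t := a t ^+ 2 + b t ^+ 2.
have s0 : 0 < s by apply: lt_le_trans s1.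
have wge0 t : 0 <= w t by rewrite addr_ge0 ?sqr_ge0.
have sqE t r : Num.sqrt (w t) `^ r = w t `^ (r / 2).
  by rewrite -powR12_sqrt// -powRrM mulrC.
pose F t := w t `^ (s / 2).
pose F' t := (s / 2 * w t `^ (s / 2 - 1)) * (2 * (a t * a' t + b t * b' t)).
have ca t : t \in `[c, d] -> {for t, continuous a}.
  move=> /da[dat _]; apply: differentiable_continuous; exact/derivable1_diffP.
have cb t : t \in `[c, d] -> {for t, continuous b}.
  move=> /db[dbt _]; apply: differentiable_continuous; exact/derivable1_diffP.
have cw t : t \in `[c, d] -> {for t, continuous w}.
  by move=> tcd; apply: cvgD; apply: cvgM; (exact: ca || exact: cb).
have dF t : t \in `[c, d] -> is_derive t 1 (F : R -> R) (F' t).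
  move=> tcd.
  have dw : is_derive t 1 (w : R -> R) (2 * (a t * a' t + b t * b' t)).
    have := is_deriveD (is_deriveX 2 (da t tcd)) (is_deriveX 2 (db t tcd)).
    rewrite (_ : _ + _ = w); last by apply/funext => r; rewrite /= !fctE.
    move/is_derive_eq; apply; rewrite /GRing.scale/= !expr1; ring.
  have H := @is_derive1_comp R (fun y : R => y `^ (s / 2)) w t _ _
    (is_derive1_powR (s / 2) (w0 t tcd)) dw.
  exact: H.
have cF' t : t \in `[c, d] -> {for t, continuous F'}.
  move=> tcd; apply: cvgM; apply: cvgM; try exact: cvg_cst.
    exact: (continuous_at_powR_gt0 (g := w) (r := s / 2 - 1) (w0 t tcd) (cw t tcd)).
  by apply: cvgD; apply: cvgM; (exact: ca || exact: cb || exact: ca' || exact: cb').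
have mF' := measurable_fun_itv_continuous cF'.
have contF t : t \in `[c, d] -> {for t, continuous F}.
  move=> /dF[dFt _]; apply: differentiable_continuous; exact/derivable1_diffP.
have cc : c \in `[c, d] by rewrite in_itv/= lexx ltW.
have dd : d \in `[c, d] by rewrite in_itv/= lexx ltW.
have ftc : (\int[@lebesgue_measure R]_(t in `[c, d]) (F' t)%:E = (F d)%:E - (F c)%:E)%E.
  apply: continuous_FTC2 => //.
  - by apply: continuous_in_subspaceT => t; rewrite inE; exact: cF'.
  - split.
    + by move=> t tcd; have [] := dF t (subset_itv_oo_cc tcd).
    + by apply: cvg_at_right_filter; exact: contF.
    + by apply: cvg_at_left_filter; exact: contF.
  - move=> t tcd; rewrite derive1E.
    by have [_ ->] := dF t (subset_itv_oo_cc tcd).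
have mI : measurable (`[c, d] : set (measurableTypeR R)) by exact: measurable_itv.
have mF'e : measurable_fun (`[c, d] : set (measurableTypeR R)) (EFin \o F').
  exact/measurable_EFinP.
have := le_abse_integral (@lebesgue_measure R) mI mF'e.
rewrite [X in (`|X| <= _)%E]ftc => absF.
rewrite !sqE -/(F c) -/(F d) -leeBlDl//.
apply: (@le_trans _ _ (`|(F d)%:E - (F c)%:E|)%E).
  by rewrite -!EFinB abse_EFin lee_fin distrC ler_norm.
apply: (le_trans absF); apply: ge0_le_integral => //.
- exact: measurableT_comp.
- exact/measurable_EFinP.
move=> t tcd; rewrite /= lee_fin; apply: le_trans (hG t tcd).
have -> : F' t = s * w t `^ (s / 2 - 1) * (a t * a' t + b t * b' t) by rewrite /F'; field.
rewrite normrM ger0_norm ?mulr_ge0 ?powR_ge0 ?(ltW s0)// -mulrA.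
apply: ler_wpM2l; first exact: ltW.
(* The factor w^(-1/2) is split off to cancel the |f| that Cauchy-Schwarz produces. *)
have -> : w t `^ (s / 2 - 1) * `|a t * a' t + b t * b' t| =
   w t `^ ((s - 1) / 2) * (w t `^ (- 2^-1) * `|a t * a' t + b t * b' t|).
  rewrite mulrA -powRD; last by rewrite (gt_eqF (w0 t tcd)) implybT.
  by congr (_ `^ _ * _); field.
rewrite sqE; apply: ler_wpM2l; first exact: powR_ge0.
rewrite powRN powR12_sqrt// ler_pdivrMl ?sqrtr_gt0 ?(w0 t tcd)//.
exact: cauchy_schwarz2.
Qed.

Lemma measurable_restrict_open (R : realType) n (D : set 'rV[R]_n) (g : 'rV[R]_n -> R) :
  open D -> (forall x, D x -> {for x, continuous g}) ->
  measurable_fun setT ((g \_ D) : borel_rV R n -> R).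
Proof.
move=> oD cg; apply: (measurability _ (RGenOInfty.measurableE R)) => _ [_ [a ->] <-].
rewrite setTI.
have oDa : open (D `&` [set x | a < g x]).
  rewrite openE => x [Dx ax]; apply: filterI; first exact: open_nbhs_nbhs.
  apply: (cg x Dx [set y | a < y]); apply: open_nbhs_nbhs; split => //; exact: open_gt.
have [a0|a0] := leP 0 a.
  rewrite (_ : _ @^-1` _ = D `&` [set x | a < g x]); first exact: open_borel_rV.
  apply/seteqP; split => x /=; rewrite in_itv/= andbT patchE.
    by case: ifPn; rewrite ?inE//= ltNge a0.
  by move=> [Dx ax]; rewrite mem_set.
rewrite (_ : _ @^-1` _ = (D `&` [set x | a < g x]) `|` ~` D).
  apply: measurableU; first exact: open_borel_rV.
  by apply: measurableC; exact: open_borel_rV.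
apply/seteqP; split => x /=; rewrite in_itv/= andbT patchE.
  by case: ifPn; rewrite ?inE ?notin_setE; [left|right].
by case=> [[Dx ax]|nDx]; [rewrite mem_set|rewrite memNset].
Qed.

Lemma normcE (R : realType) (z : R[i]) :
  normc z = Num.sqrt (complex.Re z ^+ 2 + complex.Im z ^+ 2).
Proof. by case: z. Qed.

Lemma normc_ge0 (R : realType) (z : R[i]) : 0 <= normc z.
Proof. by rewrite normcE sqrtr_ge0. Qed.

Lemma cnorm_ge0 (R : realType) n (z : 'rV[R[i]]_n) : 0 <= cnorm z.
Proof. exact: sqrtr_ge0. Qed.

Lemma normc_le_cnorm (R : realType) n (z : 'rV[R[i]]_n) j :
  normc (z ord0 j) <= cnorm z.
Proof.
rewrite /cnorm -[leLHS]ger0_norm ?normc_ge0// -sqrtr_sqr ler_wsqrtr//.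
rewrite (bigD1 j)//= lerDl; apply: sumr_ge0 => k _; exact: sqr_ge0.
Qed.

Lemma C1_continuous_normc (R : realType) n (U : set 'rV[R]_n) (f : 'rV[R]_n -> R[i]) x :
  open U -> C1_on U (fun x => complex.Re (f x)) ->
  C1_on U (fun x => complex.Im (f x)) -> U x ->
  {for x, continuous (fun y => normc (f y))}.
Proof.
move=> oU fRe fIm Ux.
rewrite (_ : (fun y => _) = (fun y => Num.sqrt (complex.Re (f y) ^+ 2 + complex.Im (f y) ^+ 2))).
  apply: (@continuous_comp _ _ _ (fun y => complex.Re (f y) ^+ 2 + complex.Im (f y) ^+ 2)
    (@Num.sqrt R)); last exact: sqrt_continuous.
  have cRe := C1_on_continuous oU fRe Ux; have cIm := C1_on_continuous oU fIm Ux.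
  exact: (cvgD (continuous_at_sqr cRe) (continuous_at_sqr cIm)).
by apply/funext => y; rewrite normcE.
Qed.

Lemma C1_continuous_cnorm_grad (R : realType) n (U : set 'rV[R]_n)
    (f : 'rV[R]_n -> R[i]) x :
  C1_on U (fun x => complex.Re (f x)) ->
  C1_on U (fun x => complex.Im (f x)) -> U x ->
  {for x, continuous (fun y => cnorm (grad f y))}.
Proof.
move=> fRe fIm Ux.
pose h (j : 'I_n) y := partial j (fun y => complex.Re (f y)) y ^+ 2 +
  partial j (fun y => complex.Im (f y)) y ^+ 2.
rewrite (_ : (fun y => _) = (fun y => Num.sqrt (\sum_j h j y))).
  apply: (@continuous_comp _ _ _ (fun y => \sum_j h j y) (@Num.sqrt R));
    last exact: sqrt_continuous.
  apply: continuous_at_sum => j.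
  have [_ cRe] := fRe x j Ux; have [_ cIm] := fIm x j Ux.
  exact: (cvgD (continuous_at_sqr cRe) (continuous_at_sqr cIm)).
apply/funext => y; congr Num.sqrt; apply: eq_bigr => j _.
by rewrite mxE normcE /= sqr_sqrtr// addr_ge0 ?sqr_ge0.
Qed.

(* Follow the line through x in the direction e_i until it leaves D or meets a
   zero of f; up to that point |f|^s is differentiable. *)
Lemma normc_powR_le_line (R : realType) n (D U : set 'rV[R]_n)
    (f : 'rV[R]_n -> R[i]) (s : R) (x : 'rV[R]_n) (i : 'I_n) :
  let g := (fun y => s * (normc (f y) `^ (s - 1) * cnorm (grad f y))) \_ D in
  let T := line_integral (EFin \o g) i x in
  open D -> bounded_set D -> open U -> closure D `<=` U ->
  C1_on U (fun x => complex.Re (f x)) -> C1_on U (fun x => complex.Im (f x)) ->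
  1 <= s -> D x -> measurable_fun setT (g : borel_rV R n -> R) ->
  ((normc (f x) `^ s)%:E <= T)%E \/
  exists2 t, boundary D (rV_set x i t) &
    ((normc (f x) `^ s)%:E <= (normc (f (rV_set x i t)) `^ s)%:E + T)%E.
Proof.
move=> g T oD bD oU DU fRe fIm s1 Dx mg.
have s0 : 0 < s by apply: lt_le_trans s1.
have g0 y : 0 <= g y.
  rewrite /g patchE; case: ifP => // _.
  by rewrite !mulr_ge0 ?powR_ge0 ?cnorm_ge0// ltW.
have T0 : (0 <= T)%E by apply: line_integral_ge0 => y; rewrite lee_fin.
have DU' y : D y -> U y by move=> Dy; apply: DU; exact: subset_closure.
pose u y := normc (f y).
have u0 y : 0 <= u y by exact: normc_ge0.
have [ux0|ux0] := eqVneq (u x) 0.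
  by left; rewrite -/(u x) ux0 powR0// gt_eqF.
pose l t := rV_set x i t; pose x0 := x ord0 i.
have lx0 : l x0 = x by exact: rV_set_id.
pose P t := D (l t) /\ 0 < u (l t).
have Px0 : P x0 by rewrite /P lx0; split => //; rewrite lt_neqAle eq_sym ux0 u0.
have nearP t : P t -> nbhs t P.
  move=> [Dt ut]; apply: (@continuous_rV_set R n x i t [set y | D y /\ 0 < u y]).
  apply: filterI; first exact: open_nbhs_nbhs.
  have := C1_continuous_normc oU fRe fIm (DU' _ Dt); move/(_ [set a | 0 < a]); apply.
  by apply: open_nbhs_nbhs; split => //; exact: open_gt.
(* The parameters past x at which the line is outside D or at a zero of f; S is nonempty because D
   is bounded, and its infimum is the stopping time. *)
pose S := [set t | x0 <= t /\ ~ P t].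
have S0 : S !=set0.
  move: bD => [M [_ hM]].
  pose m := Num.max (Num.max x0 0) (`|M| + 2).
  exists m; split; first by rewrite /m !le_max lexx.
  move=> [Dm _]; have : M < `|M| + 1 by rewrite (le_lt_trans (ler_norm M))// ltrDl.
  move=> /hM /(_ _ Dm) /=; apply/negP; rewrite -ltNge.
  apply: (@lt_le_trans _ _ `|l m ord0 i|); last exact: coord_le_normr.
  rewrite mxE eqxx; apply: (@lt_le_trans _ _ m); last exact: ler_norm.
  by rewrite /m lt_max ltrD2l ltr1n orbT.
have Slb : lbound S x0 by move=> t [].
have Sinf : has_inf S by split => //; exists x0.
pose t0 := inf S.
have PS t : x0 <= t -> t < t0 -> P t.
  move=> xt tt0; apply: contrapT => nP; move: tt0; rewrite ltNge => /negP; apply.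
  by apply: inf_lbound; [exists x0|split].
have x0t0 : x0 < t0.
  have /nbhs_ballP[e /= e0 eP] := nearP _ Px0.
  apply: (@lt_le_trans _ _ (x0 + e)); first by rewrite ltrDl.
  apply: lb_le_inf => // t [xt nP]; rewrite leNgt; apply/negP => te; apply: nP.
  apply: eP; rewrite -ball_normE /ball_/= ler0_norm ?subr_le0//; lra.
have nPt0 : ~ P t0.
  move=> /nearP /nbhs_ballP[e /= e0 eP].
  have [t1 St1 t1e] := inf_adherent e0 Sinf; rewrite -/t0 in t1e.
  have t01 : t0 <= t1 by apply: inf_lbound => //; exists x0.
  case: St1 => _; apply; apply: eP.
  rewrite -ball_normE /ball_/= ler0_norm ?subr_le0//; lra.
have left_pt N : nbhs t0 N -> exists c, [/\ x0 < c, c < t0 & N c].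
  move=> /nbhs_ballP[e /= e0 eN].
  pose c := Num.max ((x0 + t0) / 2) (t0 - e / 2).
  have cxt : (x0 + t0) / 2 <= c by rewrite /c le_max lexx.
  have ce : t0 - e / 2 <= c by rewrite /c le_max lexx orbT.
  have ct0 : c < t0 by rewrite /c gt_max; apply/andP; split; lra.
  exists c; split => //; first by lra.
  apply: eN; rewrite -ball_normE /ball_/= gtr0_norm ?subr_gt0//; lra.
have clt0 : closure D (l t0).
  move=> B /(@continuous_rV_set R n x i t0) /left_pt[c [xc ct Bc]].
  by exists (l c); split => //; have [] := PS c (ltW xc) ct.
(* The segment ends before t0, where f may vanish or the line may have left D. The passage to t0
   afterwards only uses continuity of |f|^s, available on the closure of D. *)
have main c : x0 < c -> c < t0 -> ((u x `^ s)%:E <= (u (l c) `^ s)%:E + T)%E.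
  move=> xc ct.
  have Pc t : t \in `[x0, c] -> P t.
    by rewrite in_itv/= => /andP[t1 t2]; apply: PS => //; exact: le_lt_trans ct.
  have ml : measurable_fun setT (l : measurableTypeR R -> borel_rV R n).
    apply: measurable_fun_to_rV => j; under eq_fun do rewrite mxE.
    by case: eqP => _; [exact: measurable_id|exact: measurable_cst].
  have mgl : measurable_fun setT ((g \o l) : measurableTypeR R -> R).
    exact: measurableT_comp mg ml.
  have cl t (h : 'rV[R]_n -> R) : {for l t, continuous h} -> {for t, continuous (h \o l)}.
    by move=> ch; apply: continuous_comp => //; exact: continuous_rV_set.
  have := @powR_FTC_le R (fun t => complex.Re (f (l t))) (fun t => complex.Im (f (l t)))
    (fun t => partial i (fun y => complex.Re (f y)) (l t))
    (fun t => partial i (fun y => complex.Im (f y)) (l t)) (g \o l) x0 c s xc s1.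
  have -> : Num.sqrt (complex.Re (f (l x0)) ^+ 2 + complex.Im (f (l x0)) ^+ 2) = u x.
    by rewrite lx0 -normcE.
  rewrite -normcE => H.
  apply: (le_trans (H _ _ _ _ _ _ _)).
  - move=> t /Pc[Dt _]; apply: (@is_derive_rV_set R n (fun y => complex.Re (f y))).
    by have [] := fRe _ i (DU' _ Dt).
  - move=> t /Pc[Dt _]; apply: (@is_derive_rV_set R n (fun y => complex.Im (f y))).
    by have [] := fIm _ i (DU' _ Dt).
  - by move=> t /Pc[Dt _]; apply: cl; have [] := fRe _ i (DU' _ Dt).
  - by move=> t /Pc[Dt _]; apply: cl; have [] := fIm _ i (DU' _ Dt).
  - by move=> t /Pc[_]; rewrite /u normcE sqrtr_gt0.
  - exact: measurable_funTS.
  - move=> t /Pc[Dt _]; rewrite /= /g patchE mem_set// -normcE.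
    apply: ler_wpM2l; first exact: ltW.
    apply: ler_wpM2l; first exact: powR_ge0.
    by have := normc_le_cnorm (grad f (l t)) i; rewrite mxE normcE.
  apply: leeD2l; rewrite /T /line_integral.
  apply: (@ge0_subset_integral _ _ _ (@lebesgue_measure R)) => //.
  - exact/measurable_EFinP.
  - by move=> t _; rewrite lee_fin; exact: g0.
have cphi : {for t0, continuous (fun t => u (l t) `^ s)}.
  apply: (@continuous_comp _ _ _ l (fun y => u y `^ s)); first exact: continuous_rV_set.
  by apply: continuous_at_powR => //; exact: C1_continuous_normc (DU _ clt0).
have lim : ((u x `^ s)%:E <= (u (l t0) `^ s)%:E + T)%E.
  rewrite leNgt; apply/negP => lt.
  have Tfin : T \is a fin_num.
    rewrite ge0_fin_numE// ltey; apply: contraTN lt => /eqP ->.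
    by rewrite addey// -leNgt leey.
  move: lt; rewrite -(fineK Tfin) -EFinD lte_fin -ltrBrDr => lt.
  have near_lt : nbhs t0 [set t | u (l t) `^ s < u x `^ s - fine T].
    by apply: (cphi [set a | a < _]); apply: open_nbhs_nbhs; split => //; exact: open_lt.
  have [c [xc ct /=]] := left_pt _ near_lt.
  apply/negP; rewrite -leNgt lerBlDr -lee_fin EFinD fineK//.
  exact: main.
(* If the stopping point is still in D then f vanishes there and no boundary term remains; otherwise
   it is in the closure but not in D, hence on the boundary. *)
have [Dt|nDt] := pselect (D (l t0)).
  left; apply: le_trans lim _; rewrite (_ : u (l t0) = 0) ?powR0 ?gt_eqF ?add0e//.
  by apply: contrapT => ut; apply: nPt0; split => //; rewrite lt_neqAle u0 andbT eq_sym; exact/eqP.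
right; exists t0 => //; split => //.
by move=> /interior_subset.
Qed.

(** * Absorption of the lower-order power *)

(** Both bases are at most 1 + a + b, which is at least 1; this is what allows x + y to be smaller
    than 1. *)
Lemma powR_mul_le_add1 (R : realType) (a b x y : R) :
  0 <= a -> 0 <= b -> 0 <= x -> 0 <= y -> x + y <= 1 ->
  a `^ x * b `^ y <= 1 + a + b.
Proof.
move=> a0 b0 x0 y0 xy; set c := 1 + a + b.
have c1 : 1 <= c by rewrite /c -addrA lerDl addr_ge0.
have c0 : 0 <= c by apply: le_trans c1.
apply: (@le_trans _ _ (c `^ x * c `^ y)).
  apply: ler_pM; rewrite ?powR_ge0//; apply: ge0_ler_powR => //; rewrite ?nnegrE//.
    by rewrite /c; lra.
  by rewrite /c; lra.
rewrite -powRD; last by rewrite (gt_eqF (lt_le_trans ltr01 c1)) implybT.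
by rewrite -{2}(powRr1 c0); apply: ler_powR.
Qed.

Lemma le1_powRn (R : realType) (a x : R) : 1 <= a -> 0 <= x -> 1 <= a `^ x.
Proof. by move=> a1 x0; rewrite -[leLHS](powRr0 a); exact: ler_powR. Qed.

Lemma powR_le1n (R : realType) (a x : R) :
  0 <= a -> a <= 1 -> 0 <= x -> a `^ x <= 1.
Proof.
move=> a0 a1 x0; have := @ge0_ler_powR R x x0 a 1.
by rewrite !nnegrE powR1; apply.
Qed.

(** When B > 1 one has B = N^(st), so dividing the hypothesis by N^((s-1)t) leaves N^t <= C K^t, and
    raising to the power s bounds B. *)
Lemma powR_absorb (R : realType) (B C K N s t : R) :
  1 <= s -> 0 < t -> 0 <= B -> 0 < C -> 0 < K ->
  N = Num.max 1 (B `^ (s * t)^-1) ->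
  B <= C * (K * N `^ (s - 1)) `^ t ->
  B <= Num.max 1 ((C * K `^ t) `^ s).
Proof.
move=> s1 t0 B0 C0 K0 NE BC.
have s0 : 0 < s by apply: lt_le_trans s1.
have m0 : 0 < s * t by rewrite mulr_gt0.
rewrite le_max; case: (leP B 1) => //= B1.
have NB : N `^ (s * t) = B.
  rewrite NE max_r; last by apply: le1_powRn; rewrite ?ltW// invr_gt0.
  by rewrite -powRrM mulVf ?gt_eqF// powRr1.
have N1 : 1 <= N by rewrite NE le_max lexx.
have N0 : 0 < N by apply: lt_le_trans N1.
have Nt : N `^ t <= C * K `^ t.
  rewrite -(ler_pM2r (powR_gt0 ((s - 1) * t) N0)).
  rewrite -powRD; last by rewrite (gt_eqF N0) implybT.
  rewrite (_ : t + (s - 1) * t = s * t); last by ring.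
  by rewrite NB; apply: le_trans BC _; rewrite powRM ?powR_ge0 ?(ltW K0)// -powRrM mulrA.
rewrite -NB mulrC powRrM; apply: ge0_ler_powR => //; rewrite ?nnegrE ?powR_ge0 ?(ltW s0)//.
by rewrite mulr_ge0 ?powR_ge0// ltW.
Qed.

(** The integral B of u^m, with m = st, is estimated by itself to a lower power: Young's inequality
    bounds the gradient term by a multiple of N^(s-1), where N is essentially B^(1/m), and
    [powR_absorb] concludes. The bound M on u only ensures that B is finite, so K is chosen before
    M. *)
Lemma integral_cube_powR_le (R : realType) n (L p s G : R) :
  0 < L -> 1 <= p -> 1 <= s -> 0 <= G ->
  p^-1 + (s - 1) / (s * (1 + n.+1%:R^-1)) <= 1 ->
  exists2 K : R, 0 < K &
  forall (u v : borel_rV R n.+1 -> R) (Gam : 'I_n.+1 -> borel_rV R n.+1 -> \bar R) (M : R),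
  measurable_fun setT u -> measurable_fun setT v ->
  (forall x, 0 <= u x <= M) -> (forall x, 0 <= v x) ->
  (forall x, ~ cube L x -> v x = 0) ->
  (forall i, measurable_fun setT (Gam i)) -> (forall i x, 0 <= Gam i x)%E ->
  (forall i x t, Gam i (rV_set x i t) = Gam i x) ->
  (forall i x, ((u x `^ s)%:E <=
    line_integral (fun y => (s * (u y `^ (s - 1) * v y))%:E) i x + Gam i x)%E) ->
  (\int[lebesgue_rV R n.+1]_(x in cube L) (v x `^ p)%:E <= 1)%E ->
  (forall i, \int[lebesgue_rV R n.+1]_(x in cube L) Gam i x <= G%:E)%E ->
  (\int[lebesgue_rV R n.+1]_(x in cube L) (u x `^ (s * (1 + n.+1%:R^-1)))%:E <= K%:E)%E.
Proof.
move=> L0 p1 s1 G0; set t := 1 + n.+1%:R^-1; set m := s * t => psm.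
have t0 : 0 < t by rewrite /t addr_gt0// invr_gt0.
have s0 : 0 < s by apply: lt_le_trans s1.
have p0 : 0 < p by apply: lt_le_trans p1.
have m0 : 0 < m by rewrite mulr_gt0.
have s10 : 0 <= s - 1 by rewrite subr_ge0.
have [C C0 HC] := cube_sum_powR_le n L0.
set V := (2 * L) ^+ n.+1.
have V0 : 0 < V by rewrite exprn_gt0// mulr_gt0.
have L20 : 0 < 2 * L by rewrite mulr_gt0.
(* The gradient term has integral at most s N^(s-1) (V + 2), its line integrals gain the side 2L,
   and G bounds the integral of [Gam]. *)
pose K1 := 2 * L * (s * (V + 2)) + G.
have K10 : 0 < K1 by rewrite /K1 ltr_wpDr// !mulr_gt0// addr_gt0.
exists (Num.max 1 ((C * K1 `^ t) `^ s)).
  by rewrite lt_max ltr01.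
move=> u v Gam M mu mv uM v0 vcube mG Gam0 GamI line vp GamG.
have u0 x : 0 <= u x by have /andP[] := uM x.
have mC : measurable (cube L : set (borel_rV R n.+1)) by exact: measurable_cube.
have mP (h : borel_rV R n.+1 -> R) (e : R) : measurable_fun setT h ->
    measurable_fun setT (fun x => h x `^ e).
  by move=> mh; apply: (measurableT_comp (@measurable_powR R e)).
have VE : lebesgue_rV R n.+1 (cube L) = V%:E by exact: (lebesgue_rV_cube n.+1 (ltW L0)).
have Bub : (\int[lebesgue_rV R n.+1]_(x in cube L) (u x `^ m)%:E <= (M `^ m * V)%:E)%E.
  apply: (@le_trans _ _ (\int[lebesgue_rV R n.+1]_(x in cube L) (M `^ m)%:E)%E).
    apply: ge0_le_integral => //.
    - by move=> x _; rewrite lee_fin powR_ge0.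
    - by apply/measurable_EFinP; apply: measurable_funTS; exact: mP.
    - move=> x _; have /andP[ux xM] := uM x.
      by rewrite lee_fin ge0_ler_powR// ?nnegrE// ?(le_trans ux xM)// ltW.
  by rewrite integral_cst// [X in (_ * X <= _)%E]VE.
have B0e : (0 <= \int[lebesgue_rV R n.+1]_(x in cube L) (u x `^ m)%:E)%E.
  by apply: integral_ge0 => x _; rewrite lee_fin powR_ge0.
have Bfin : (\int[lebesgue_rV R n.+1]_(x in cube L) (u x `^ m)%:E)%E \is a fin_num.
  by rewrite ge0_fin_numE//; apply: le_lt_trans Bub _; exact: ltry.
set B := fine (\int[lebesgue_rV R n.+1]_(x in cube L) (u x `^ m)%:E)%E.
have BE : (\int[lebesgue_rV R n.+1]_(x in cube L) (u x `^ m)%:E)%E = B%:E by rewrite /B fineK.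
have B0 : 0 <= B by rewrite -lee_fin -BE.
(* The maximum with 1 makes N invertible and lets G be bounded by G N^(s-1). *)
pose N := Num.max 1 (B `^ m^-1).
have N1 : 1 <= N by rewrite le_max lexx.
have N0 : 0 < N by apply: lt_le_trans N1.
have NB : B <= N `^ m.
  rewrite -[leLHS]powRr1// -(mulVf (lt0r_neq0 m0)) powRrM.
  apply: ge0_ler_powR; rewrite ?nnegrE ?powR_ge0 ?(ltW m0) ?(ltW N0)//.
  by rewrite /N le_max lexx orbT.
pose g y := s * (u y `^ (s - 1) * v y).
have g0 y : 0 <= g y by rewrite /g !mulr_ge0 ?powR_ge0 ?(ltW s0).
have mg : measurable_fun setT (g : borel_rV R n.+1 -> R).
  apply: measurable_funM => //; apply: measurable_funM => //; exact: mP.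
have Ns0 : 0 <= s * N `^ (s - 1) by rewrite mulr_ge0 ?powR_ge0// ltW.
(* Young's inequality for v^p and (u/N)^m with exponents 1/p and (s-1)/m. Dividing u by N keeps the
   integral of the last term at most 1, at the price of the factor N^(s-1). *)
have young x : g x <= s * N `^ (s - 1) * (1 + v x `^ p + (N `^ m)^-1 * u x `^ m).
  have -> : g x = s * N `^ (s - 1) * ((v x `^ p) `^ p^-1 * ((u x / N) `^ m) `^ ((s - 1) / m)).
    rewrite -!powRrM divff ?gt_eqF// powRr1// [m * _]mulrC divfK ?gt_eqF//.
    rewrite powRM ?invr_ge0 ?(ltW N0)// -[N^-1]powR_inv1 ?(ltW N0)// -powRrM mulN1r powRN.
    by rewrite /g; field; rewrite gt_eqF// powR_gt0.
  apply: ler_wpM2l => //.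
  have -> : (N `^ m)^-1 * u x `^ m = (u x / N) `^ m.
    rewrite powRM ?invr_ge0 ?(ltW N0)// -[N^-1]powR_inv1 ?(ltW N0)// -powRrM mulN1r powRN.
    by rewrite mulrC.
  apply: powR_mul_le_add1; rewrite ?powR_ge0 ?invr_ge0 ?(ltW p0)//.
  by rewrite divr_ge0 ?(ltW m0).
have intg : (\int[lebesgue_rV R n.+1]_x (g x)%:E <= (s * N `^ (s - 1) * (V + 2))%:E)%E.
  have -> : (\int[lebesgue_rV R n.+1]_x (g x)%:E =
      \int[lebesgue_rV R n.+1]_(x in cube L) (g x)%:E)%E.
    rewrite [RHS]integral_mkcond; apply: eq_integral => x _; rewrite patchE.
    by case: ifPn => //; rewrite notin_setE => /vcube vx; rewrite /g vx !mulr0.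
  apply: (@le_trans _ _ (\int[lebesgue_rV R n.+1]_(x in cube L)
    ((s * N `^ (s - 1))%:E * (1%:E + (v x `^ p)%:E + (N `^ m)^-1%:E * (u x `^ m)%:E)))%E).
    apply: ge0_le_integral => //.
    - by move=> x _; rewrite lee_fin.
    - by apply/measurable_EFinP; exact: measurable_funTS.
    - apply: measurable_funeM; apply: emeasurable_funD.
        apply: emeasurable_funD => //; apply/measurable_EFinP.
        by apply: measurable_funTS; exact: mP.
      by apply: measurable_funeM; apply/measurable_EFinP; apply: measurable_funTS; exact: mP.
    - by move=> x _; move: (young x); rewrite -lee_fin [leRHS]EFinM !EFinD [X in (_ + X)%E]EFinM.
  have mu' : measurable_fun (cube L : set (borel_rV R n.+1)) (fun x => (u x `^ m)%:E).
    by apply/measurable_EFinP; apply: measurable_funTS; exact: mP.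
  have mv' : measurable_fun (cube L : set (borel_rV R n.+1)) (fun x => (v x `^ p)%:E).
    by apply/measurable_EFinP; apply: measurable_funTS; exact: mP.
  have Nm0 : 0 <= (N `^ m)^-1 by rewrite invr_ge0 powR_ge0.
  have e1 x : (0 <= (v x `^ p)%:E)%E by rewrite lee_fin powR_ge0.
  have e2 x : (0 <= (u x `^ m)%:E)%E by rewrite lee_fin powR_ge0.
  have e3 x : (0 <= (N `^ m)^-1%:E * (u x `^ m)%:E)%E by apply: mule_ge0; rewrite ?e2 ?lee_fin.
  have e4 x : (0 <= 1%:E + (v x `^ p)%:E)%E by apply: adde_ge0; rewrite ?e1 ?lee_fin.
  rewrite ge0_integralZl//; last 2 first.
  - apply: emeasurable_funD; first exact: emeasurable_funD.
    exact: measurable_funeM.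
  - by move=> x _; rewrite adde_ge0.
  rewrite [leRHS]EFinM; apply: lee_wpmul2l; first by rewrite lee_fin.
  rewrite ge0_integralD//; last 2 first.
  - exact: emeasurable_funD.
  - exact: measurable_funeM.
  rewrite ge0_integralD// integral_cst// [X in (_ * X + _ + _)%E]VE mul1e.
  rewrite ge0_integralZl// BE -EFinM (_ : V + 2 = V + 1 + 1)%R; last by ring.
  rewrite !EFinD; apply: leeD; first by apply: leeD.
  by rewrite lee_fin mulrC ler_pdivrMr ?powR_gt0// mul1r.
have AH i : (\int[lebesgue_rV R n.+1]_(x in cube L)
    (line_integral (EFin \o g) i x + Gam i x) <= (K1 * N `^ (s - 1))%:E)%E.
  have mge : measurable_fun setT (EFin \o g : borel_rV R n.+1 -> \bar R) by exact/measurable_EFinP.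
  have g0e x : (0 <= (EFin \o g) x)%E by rewrite lee_fin.
  rewrite ge0_integralD//; last 3 first.
  - by move=> x _; exact: line_integral_ge0.
  - by apply: measurable_funTS; exact: measurable_line_integral.
  - exact: measurable_funTS.
  rewrite /K1 mulrDl EFinD; apply: leeD; last first.
    apply: le_trans (GamG i) _; rewrite lee_fin -{1}(mulr1 G) ler_wpM2l//.
    exact: le1_powRn.
  apply: le_trans (integral_cube_line_integral_le i (ltW L0) mge g0e) _.
  apply: (@le_trans _ _ ((2 * L)%:E * (s * N `^ (s - 1) * (V + 2))%:E)%E).
    by apply: lee_wpmul2l => //; rewrite lee_fin ltW.
  by rewrite -EFinM lee_fin le_eqVlt; apply/orP; left; apply/eqP; ring.
rewrite BE lee_fin.
apply: (@powR_absorb _ B C K1 N s t) => //.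
have := HC (fun x => u x `^ s) (fun i x => line_integral (EFin \o g) i x + Gam i x)%E
   (K1 * N `^ (s - 1)).
rewrite -/t -lee_fin -BE => H.
rewrite (eq_integral (fun x => ((u x `^ s) `^ t)%:E)); last first.
  by move=> x _; rewrite -powRrM.
apply: H => //.
- by rewrite mulr_gt0// powR_gt0.
- exact: mP.
- by move=> x; exact: powR_ge0.
- move=> i; apply: emeasurable_funD => //; apply: measurable_line_integral => //.
  exact/measurable_EFinP.
- by move=> i x; rewrite adde_ge0//; apply: line_integral_ge0 => y; rewrite lee_fin.
- by move=> i x r; rewrite line_integral_set GamI.
Qed.

(** * The inequality for bounded open sets *)

Lemma closed_continuous_level (R : realType) n (B : set 'rV[R]_n)
    (w : 'rV[R]_n -> R) (c : R) :
  closed B -> (forall x, B x -> {for x, continuous w}) ->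
  closed (B `&` [set x | c <= w x]).
Proof.
move=> cB cw x clx; have Bx : B x.
  by apply: cB; apply: closureS clx; exact: subIsetl.
split => //=; rewrite leNgt; apply/negP => wc.
have [y [[_ /=]]] : (B `&` [set x | c <= w x]) `&` [set y | w y < c] !=set0.
  apply: clx; apply: (cw x Bx [set a | a < c]).
  by apply: open_nbhs_nbhs; split => //; exact: open_lt.
by rewrite leNgt => /negP.
Qed.

Lemma compact_continuous_ubound (R : realType) n (A : set 'rV[R]_n)
    (g : 'rV[R]_n -> R) :
  compact A -> (forall x, A x -> {for x, continuous g}) ->
  exists M, forall x, A x -> g x <= M.
Proof.
move=> cA cg.
have /compact_bounded[M [_ hM]] : compact (g @` A).
  apply: continuous_compact cA; apply: continuous_in_subspaceT => x.
  by rewrite inE; exact: cg.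
exists (M + 1) => x Ax; apply: le_trans (ler_norm _) _.
by apply: (hM (M + 1)); [rewrite ltrDl|exists x].
Qed.

Lemma closed_boundary (R : realType) n (D : set 'rV[R]_n) : closed (boundary D).
Proof.
rewrite /boundary setDE; apply: closedI; first exact: closed_closure.
by apply: open_closedC; exact: open_interior.
Qed.

Lemma bounded_closure_rV (R : realType) n (D : set 'rV[R]_n) :
  bounded_set D -> bounded_set (closure D).
Proof.
move=> [M [Mr hM]]; exists (M + 2); split; first by rewrite num_real.
move=> a Ma x /(_ _ (nbhsx_ballx x _ ltr01))[y [Dy xy]] /=.
have yM : `|y| <= M + 1 by apply: (hM (M + 1)) => //; rewrite ltrDl.
rewrite -(subrK y x); apply: le_trans (ler_normD _ _) _.
move: xy; rewrite -ball_normE /ball_/=; lra.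
Qed.

(** Turns bounds on norms into bounds on integrals of powers and back; when the integral is infinite
    both sides fail. *)
Lemma Lnorm_leP (R : realType) d (T : measurableType d)
    (mu : {measure set T -> \bar R}) (p l : R) (h : T -> R) :
  0 < p -> 0 <= l -> (forall x, 0 <= h x) ->
  ('N[mu]_p%:E [EFin \o h] <= l%:E)%E <->
  (\int[mu]_x (h x `^ p)%:E <= (l `^ p)%:E)%E.
Proof.
move=> p0 l0 h0; rewrite unlock.
have -> : (\int[mu]_x (`|(EFin \o h) x| `^ p) = \int[mu]_x (h x `^ p)%:E)%E.
  by apply: eq_integral => x _; rewrite /= ger0_norm.
have : (0 <= \int[mu]_x (h x `^ p)%:E)%E.
  by apply: integral_ge0 => x _; rewrite lee_fin powR_ge0.
case: (\int[mu]_x (h x `^ p)%:E)%E => [r|_|//].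
  rewrite lee_fin => r0; rewrite poweR_EFin !lee_fin; split => H.
    rewrite -(powRr1 r0) -(mulVf (lt0r_neq0 p0)) powRrM.
    by apply: ge0_ler_powR; rewrite ?nnegrE ?powR_ge0 ?(ltW p0).
  rewrite -[leRHS](powRr1 l0) -(divff (lt0r_neq0 p0)) powRrM.
  by apply: ge0_ler_powR; rewrite ?nnegrE ?powR_ge0 ?invr_ge0 ?(ltW p0).
rewrite poweRyr ?gt_eqF ?invr_gt0//; split => //.
Qed.

Lemma integral_scale_le1 (R : realType) d (T : measurableType d)
    (mu : {measure set T -> \bar R}) (k : R) (h h' : T -> R) :
  0 < k -> measurable_fun setT h -> (forall x, 0 <= h x) ->
  (forall x, h' x = k * h x) -> (\int[mu]_x (h' x)%:E <= k%:E)%E ->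
  (\int[mu]_x (h x)%:E <= 1)%E.
Proof.
move=> k0 mh h0 hE; rewrite (eq_integral (fun x => k%:E * (h x)%:E)%E); last first.
  by move=> x _; rewrite hE EFinM.
have mhE : measurable_fun setT (EFin \o h) by exact/measurable_EFinP.
have h0E x : [set: T] x -> (0 <= (h x)%:E)%E by rewrite lee_fin.
rewrite ge0_integralZl ?lee_fin ?(ltW k0)//.
by rewrite -{2}(mule1 k%:E) lee_pmul2l.
Qed.

Lemma line_integralZ (R : realType) n (g : borel_rV R n -> \bar R) (k : R) i x :
  measurable_fun setT g -> (forall y, 0 <= g y)%E -> 0 <= k ->
  (line_integral (fun y => k%:E * g y) i x = k%:E * line_integral g i x)%E.
Proof.
move=> mg g0 k0; rewrite /line_integral ge0_integralZl//.
apply: (measurableT_comp mg); apply: measurable_fun_to_rV => j.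
under eq_fun do rewrite mxE.
by case: eqP => _; [exact: measurable_id|exact: measurable_cst].
Qed.

(** Write N = n+1. The first strict inequality says 1/p - 1/q < 1/(2N); for s = q/t the last bound
    amounts to 1/p - 1/q <= 1/(N+1), and N+1 <= 2N. The second one gives s <= r because N/(N+1) <=
    (2N-1)/(2N). *)
Lemma exponent_bounds (R : realType) n (p q r t s : R) :
  1 <= p -> 1 <= q -> 1 <= r -> t = 1 + n.+1%:R^-1 -> s = Num.max 1 (q / t) ->
  q * (2 * n.+1%:R - p) < 2 * n.+1%:R * p ->
  q * (2 * n.+1%:R - 1) < 2 * n.+1%:R * r ->
  [/\ 1 <= s, s <= r, q <= s * t & p^-1 + (s - 1) / (s * t) <= 1].
Proof.
move=> p1 q1 r1 tE sE.
have : 1 <= n.+1%:R :> R by rewrite ler1n.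
move: (n.+1%:R) tE => N tE N1 pq qr.
have N0 : 0 < N by lra.
have t0 : 0 < t by rewrite tE addr_gt0// invr_gt0.
have tN : t * N = N + 1 by rewrite tE mulrDl mul1r mulVf// gt_eqF.
have s1 : 1 <= s by rewrite sE le_max lexx.
split => //.
- rewrite sE ge_max r1/= ler_pdivrMr//.
  rewrite -(ler_pM2r N0) -mulrA tN.
  have N2 : 0 < 2 * N - 1 by lra.
  rewrite -(ler_pM2r N2); nra.
- by rewrite -ler_pdivrMr// sE le_max lexx orbT.
- have p0 : 0 < p by lra.
  have q0 : 0 < q by lra.
  have s0 : 0 < s by lra.
  move: sE; case: (leP 1 (q / t)) => qt sE; last first.
    by rewrite sE subrr mul0r addr0 invf_le1//; lra.
  have -> : s * t = q by rewrite sE divfK// gt_eqF.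
  rewrite sE -(ler_pM2r (mulr_gt0 (mulr_gt0 p0 q0) (addr_gt0 N0 ltr01))).
  have -> : t = (N + 1) / N by rewrite -tN mulfK// gt_eqF.
  have -> : (p^-1 + (q / ((N + 1) / N) - 1) / q) * (p * q * (N + 1)) =
     q * (N + 1) + p * q * N - p * (N + 1).
    by field; rewrite !gt_eqF// addr_gt0.
  case: (leP q p) => qp; nra.
Qed.

(** The preceding estimates are not homogeneous, so they are applied to f/l extended by zero. Taking
    for l a positive upper bound of both norms, rather than their values, makes the division
    harmless. *)
Lemma Lp_domain_le (R : realType) n (D : set 'rV[R]_n.+1) (p q r : R) :
  open D -> bounded_set D -> 1 <= p -> 1 <= q -> 1 <= r ->
  q * (2 * n.+1%:R - p) < 2 * n.+1%:R * p ->
  q * (2 * n.+1%:R - 1) < 2 * n.+1%:R * r ->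
  exists2 K : R, 0 < K &
  forall (f : 'rV[R]_n.+1 -> R[i]) (l : R), C1_closure D f -> 0 < l ->
  (Lp_domain D p (fun x => cnorm (grad f x)) <= l%:E)%E ->
  (Lp_boundary D r (fun x => normc (f x)) <= l%:E)%E ->
  (Lp_domain D q (fun x => normc (f x)) <= (K * l)%:E)%E.
Proof.
move=> oD bD p1 q1 r1 pq qr.
have [p0 q0 r0] : [/\ 0 < p, 0 < q & 0 < r] by split; lra.
pose t : R := 1 + n.+1%:R^-1; pose s := Num.max 1 (q / t).
have [s1 sr qm psm] := exponent_bounds p1 q1 r1 (erefl t) (erefl s) pq qr.
have s0 : 0 < s by lra.
have [L L0 DL] : exists2 L : R, 0 < L & D `<=` cube L.
  move: bD => [M [_ hM]]; exists (`|M| + 1); first by rewrite ltr_wpDl.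
  move=> x Dx i; apply: le_trans (coord_le_normr x i) _.
  by apply: (hM (`|M| + 1)) => //; rewrite (le_lt_trans (ler_norm M))// ltrDl.
have [C C0 HC] := hausdorff_projection n L0.
set V := (2 * L) ^+ n.+1.
have V0 : 0 < V by rewrite exprn_gt0// mulr_gt0.
(* After normalization the boundary integral is at most 1, so the projection bound is 2C; V is the
   cost of the 1 that is added to [Gam] below. *)
have G0 : 0 <= 2 * C + V by rewrite addr_ge0 ?(ltW V0)// mulr_ge0// ltW.
have [K K0 HK] := integral_cube_powR_le L0 p1 s1 G0 psm.
have VK0 : 0 < V + K by rewrite addr_gt0.
(* Since q <= st, the q-th power of the normalized function is at most 1 plus its st-th power, whose
   integral over the cube is at most V + K. *)
exists ((V + K) `^ q^-1); first exact: powR_gt0.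
move=> f l [U [oU DU fRe fIm]] l0 gradl bdl.
pose u x := normc (f x); pose v x := cnorm (grad f x).
have u0 x : 0 <= u x by exact: normc_ge0.
have v0 x : 0 <= v x by exact: cnorm_ge0.
have DU' : D `<=` U by apply: subset_trans DU; exact: subset_closure.
have BU : boundary D `<=` U by move=> x [] /DU.
have cu x : U x -> {for x, continuous u} by exact: C1_continuous_normc.
have cv x : U x -> {for x, continuous v} by exact: C1_continuous_cnorm_grad.
have uD0 x : 0 <= (u \_ D) x by rewrite patchE; case: ifP.
have vD0 x : 0 <= (v \_ D) x by rewrite patchE; case: ifP.
have mu : measurable_fun setT ((u \_ D) : borel_rV R n.+1 -> R).
  by apply: measurable_restrict_open => // x /DU'; exact: cu.
have mv : measurable_fun setT ((v \_ D) : borel_rV R n.+1 -> R).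
  by apply: measurable_restrict_open => // x /DU'; exact: cv.
have [M0 HM0] : exists M, forall x, closure D x -> u x <= M.
  apply: compact_continuous_ubound => [|x /DU]; last exact: cu.
  by apply: bounded_closed_compact; [exact: bounded_closure_rV|exact: closed_closure].
pose M := Num.max M0 0.
have M00 : 0 <= M by rewrite le_max lexx orbT.
have HM x : closure D x -> u x <= M by move=> /HM0 h; rewrite le_max h.
pose u' x := (u \_ D) x / l; pose v' x := (v \_ D) x / l.
have u'0 x : 0 <= u' x by rewrite divr_ge0 ?(ltW l0).
have v'0 x : 0 <= v' x by rewrite divr_ge0 ?(ltW l0).
have mu' : measurable_fun setT (u' : borel_rV R n.+1 -> R) by exact: measurable_funM.
have mv' : measurable_fun setT (v' : borel_rV R n.+1 -> R) by exact: measurable_funM.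
have mP (h : borel_rV R n.+1 -> R) (e : R) : measurable_fun setT h ->
    measurable_fun setT (fun x => h x `^ e).
  by move=> mh; apply: (measurableT_comp (@measurable_powR R e)).
have mC : measurable (cube L : set (borel_rV R n.+1)) by exact: measurable_cube.
have powl e a : 0 <= a -> a `^ e = l `^ e * (a / l) `^ e.
  move=> a0; rewrite -powRM ?divr_ge0 ?(ltW l0)// mulrCA divff ?mulr1//.
  by rewrite gt_eqF.
have vp : (\int[lebesgue_rV R n.+1]_(x in cube L) (v' x `^ p)%:E <= 1)%E.
  have mvp : measurable_fun setT ((fun x => (v' x `^ p)%:E) : borel_rV R n.+1 -> \bar R).
    by apply/measurable_EFinP; exact: mP.
  apply: (@le_trans _ _ (\int[lebesgue_rV R n.+1]_x (v' x `^ p)%:E)%E).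
    by apply: ge0_subset_integral => // x _; rewrite lee_fin powR_ge0.
  have lp0 : 0 < l `^ p by exact: powR_gt0.
  apply: (@integral_scale_le1 R _ _ (lebesgue_rV R n.+1) (l `^ p) (fun x => v' x `^ p)
    (fun x => (v \_ D) x `^ p) lp0) => [|x|x|].
  - exact: mP.
  - exact: powR_ge0.
  - exact: powl.
  - exact: (Lnorm_leP (lebesgue_rV R n.+1) p0 (ltW l0) vD0).1 gradl.
pose w x := (u x / l) `^ r.
have w0 x : 0 <= w x by exact: powR_ge0.
have cw x : boundary D x -> {for x, continuous w}.
  move=> /BU /cu cux; apply: (@continuous_at_powR R _ (fun y => u y / l) r x r0).
    by move=> y; rewrite divr_ge0 ?(ltW l0).
  exact: continuous_at_mulr.
have lw c : closed (boundary D `&` [set x | c <= w x]).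
  by apply: closed_continuous_level => //; exact: closed_boundary.
have wM x : boundary D x -> w x <= (M / l) `^ r.
  move=> [/HM xM _]; apply: ge0_ler_powR; rewrite ?nnegrE ?divr_ge0 ?(ltW l0) ?(ltW r0)//.
  by rewrite ler_pM2r ?invr_gt0.
set hm := caratheodory_measure (@hausdorff R n.+1 n).
have hw : (\int[hm]_x (w \_ (boundary D) x)%:E <= 1)%E.
  have lr0 : 0 < l `^ r by exact: powR_gt0.
  have uB0 x : 0 <= (u \_ (boundary D)) x by rewrite patchE; case: ifP.
  apply: (@integral_scale_le1 R _ _ hm (l `^ r) (w \_ (boundary D))
    (fun x => (u \_ (boundary D)) x `^ r) lr0) => [|x|x|].
  - exact: measurable_restrict_closed_levels.
  - by rewrite patchE; case: ifP.
  - rewrite !patchE; case: ifP => _; first exact: powl.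
    by rewrite mulr0 powR0// gt_eqF.
  - exact: (Lnorm_leP hm r0 (ltW l0) uB0).1 bdl.
have /choice[Gam hGam] : forall i, exists G : borel_rV R n.+1 -> \bar R,
  [/\ measurable_fun setT G, (forall x, 0 <= G x)%E,
      forall x t, G (rV_set x i t) = G x,
      (forall b t, boundary D b -> (w b)%:E <= G (rV_set b i t))%E &
      (\int[lebesgue_rV R n.+1]_(x in cube L) G x <= C%:E * 2%:E)%E].
  move=> i; have [G [h1 h2 h3 h4 h5]] := HC (boundary D) w _ i w0 wM lw.
  exists G; split => //; apply: le_trans h5 _; apply: lee_wpmul2l; first by rewrite lee_fin ltW.
  by rewrite (_ : 2 = 1 + 1 :> R)// EFinD leeD2r.
pose g' y := s * (u' y `^ (s - 1) * v' y).
have g'0 y : 0 <= g' y.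
  by apply: mulr_ge0 (ltW s0) _; exact: mulr_ge0 (powR_ge0 _ _) (v'0 y).
have mg' : measurable_fun setT (g' : borel_rV R n.+1 -> R).
  by apply: measurable_funM => //; apply: measurable_funM => //; exact: mP.
have ls0 : 0 < l `^ s by exact: powR_gt0.
pose g := (fun y => s * (normc (f y) `^ (s - 1) * cnorm (grad f y))) \_ D.
have gE y : g y = l `^ s * g' y.
  rewrite /g /g' /u' /v' !patchE; case: ifP => _; last by rewrite !mul0r !mulr0.
  rewrite -/(u y) -/(v y) (powl (s - 1) (u y) (u0 y)).
  have -> : l `^ s = l `^ (s - 1) * l.
    rewrite -[X in _ * X]powRr1 ?(ltW l0)// -powRD ?subrK//.
    by rewrite (gt_eqF l0) implybT.
  field; exact/lt0r_neq0.
have mg : measurable_fun setT (g : borel_rV R n.+1 -> R).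
  rewrite (_ : g = fun y => l `^ s * g' y); last by apply/funext => y; rewrite gE.
  exact: measurable_funM.
have TE i x : (line_integral (EFin \o g) i x =
    (l `^ s)%:E * line_integral (fun y => (g' y)%:E) i x)%E.
  rewrite -line_integralZ ?(ltW ls0)//.
  - by apply: eq_integral => r' _; rewrite -EFinM; congr EFin; exact: gE.
  - exact/measurable_EFinP.
have T0 i x : (0 <= line_integral (fun y => (g' y)%:E) i x)%E.
  by apply: line_integral_ge0 => y; rewrite lee_fin.
have Gam0 i x : (0 <= Gam i x)%E by have [_ h _ _ _] := hGam i; exact: h.
have GamI i x e : Gam i (rV_set x i e) = Gam i x by have [_ _ h _ _] := hGam i; exact: h.
(* [Gam] controls the r-th power at the boundary point, while the s-th is needed; since s <= r the
   latter is at most 1 plus the former. *)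
have line i x : ((u' x `^ s)%:E <=
    line_integral (fun y => (g' y)%:E) i x + (Gam i x + 1))%E.
  have G10 : (0 <= Gam i x + 1)%E by rewrite adde_ge0.
  case: (boolP (x \in D)) => [|xD]; last first.
    by rewrite /u' patchE (negbTE xD) mul0r powR0 ?gt_eqF// adde_ge0.
  rewrite inE => Dx.
  have ux : u' x = u x / l by rewrite /u' patchE mem_set.
  rewrite -(@lee_pmul2l _ (l `^ s)%:E)// -EFinM ux -(powl s _ (u0 x)).
  rewrite ge0_muleDr// -TE.
  have [h|[e Be h]] := normc_powR_le_line i oD bD oU DU fRe fIm s1 Dx mg.
    by apply: le_trans h _; rewrite leeDl// mule_ge0 ?lee_fin ?(ltW ls0).
  apply: le_trans h _; rewrite addeC; apply: leeD => //.
  rewrite (powl s _ (u0 (rV_set x i e))) EFinM; apply: lee_wpmul2l; first by rewrite lee_fin ltW.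
  (* Moving the boundary point back along its line to the i-th coordinate of x gives x itself, so
     the bound is read off at x. *)
  have [_ _ _ hb _] := hGam i; have := hb _ (x ord0 i) Be.
  rewrite rV_set_set rV_set_id => wG.
  apply: (@le_trans _ _ ((w (rV_set x i e))%:E + 1)%E); last exact: leeD2r.
  rewrite -EFinD lee_fin /w -/(u (rV_set x i e)).
  have : 0 <= u (rV_set x i e) / l by rewrite divr_ge0 ?(ltW l0).
  move: (u _ / l) => a a0; case: (leP 1 a) => a1.
    by apply: le_trans (ler_powR a1 sr) _; rewrite lerDl.
  apply: (@le_trans _ _ 1); last by rewrite lerDr powR_ge0.
  exact: powR_le1n (ltW a1) (ltW s0).
have mGam i : measurable_fun setT (fun x => Gam i x + 1)%E.
  by apply: emeasurable_funD => //; have [] := hGam i.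
have main : (\int[lebesgue_rV R n.+1]_(x in cube L) (u' x `^ (s * t))%:E <= K%:E)%E.
  apply: (HK u' v' (fun i x => Gam i x + 1)%E (M / l)) => //.
  - move=> x; rewrite u'0 /u' ler_pM2r ?invr_gt0// patchE; case: ifPn => // /set_mem Dx.
    by apply: HM; exact: subset_closure.
  - move=> x nLx; rewrite /v' patchE memNset ?mul0r// => Dx.
    by apply: nLx; exact: DL.
  - by move=> i x; rewrite adde_ge0.
  - by move=> i x e; rewrite GamI.
  - move=> i; rewrite ge0_integralD//; last by have [h _ _ _ _] := hGam i; exact: measurable_funTS.
    rewrite integral_cst// [X in (_ + _ * X <= _)%E](lebesgue_rV_cube n.+1 (ltW L0)) mul1e.
    rewrite EFinD; apply: leeD => //.
    by have [_ _ _ _ h] := hGam i; apply: le_trans h _; rewrite -EFinM mulrC.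
have K'0 : 0 <= (V + K) `^ q^-1 * l by rewrite mulr_ge0 ?powR_ge0 ?(ltW l0).
apply/(Lnorm_leP (lebesgue_rV R n.+1) q0 K'0 uD0).
rewrite powRM ?powR_ge0 ?(ltW l0)// -powRrM mulVf ?gt_eqF// powRr1 ?(ltW VK0)//.
have mum : measurable_fun (cube L : set (borel_rV R n.+1)) (fun x => (u' x `^ (s * t))%:E).
  by apply/measurable_EFinP; apply: measurable_funTS; exact: mP.
have lq0 : 0 <= l `^ q by exact: powR_ge0.
apply: (@le_trans _ _ (\int[lebesgue_rV R n.+1]_(x in cube L)
   ((l `^ q)%:E * (1%:E + (u' x `^ (s * t))%:E)))%E).
  rewrite [leRHS]integral_mkcond; apply: ge0_le_integral => //.
  - by move=> x _; rewrite lee_fin powR_ge0.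
  - by apply/measurable_EFinP; exact: mP.
  - apply/(measurable_restrictT _ _).1 => //; apply: measurable_funeM.
    exact: emeasurable_funD.
  move=> x _; rewrite [in leRHS]patchE; case: ifPn => [_|]; last first.
    rewrite notin_setE => nLx; rewrite patchE memNset ?powR0 ?gt_eqF// => Dx.
    by apply: nLx; exact: DL.
  rewrite (powl q _ (uD0 x)) EFinM; apply: lee_wpmul2l; first by rewrite lee_fin.
  rewrite -EFinD lee_fin; case: (leP 1 (u' x)) => a1.
    by apply: le_trans (ler_powR a1 qm) _; rewrite lerDr.
  apply: (@le_trans _ _ 1); last by rewrite lerDl powR_ge0.
  exact: powR_le1n (ltW a1) (ltW q0).
have um0 x : cube L x -> (0 <= (u' x `^ (s * t))%:E)%E by rewrite lee_fin powR_ge0.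
rewrite ge0_integralZl//; last 2 first.
- exact: emeasurable_funD.
- by move=> x Lx; rewrite adde_ge0// um0.
rewrite [leRHS]EFinM muleC; apply: lee_wpmul2r; first by rewrite lee_fin.
rewrite ge0_integralD// integral_cst// [X in (_ * X + _)%E](lebesgue_rV_cube n.+1 (ltW L0)).
by rewrite mul1e EFinD; apply: leeD.
Qed.

Theorem corollary1p5 (R : realType) (n : nat) (D : set 'rV[R]_n) (p q r : R)
    (n_gt0 : (0 < n)%N)
    (domD : domain D) (bndD : bounded_set D) (lipD : lipschitz_boundary D)
    (p_ge1 : 1 <= p) (q_ge1 : 1 <= q) (r_ge1 : 1 <= r)
    (pq : q * (2 * n%:R - p) < 2 * n%:R * p)
    (qr : q * (2 * n%:R - 1) < 2 * n%:R * r) :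
  exists2 delta : R, 0 < delta &
    forall f : 'rV[R]_n -> R[i], C1_closure D f ->
      (delta%:E * Lp_domain D q (fun x => normc (f x)) <=
       Lp_domain D p (fun x => cnorm (grad f x)) +
       Lp_boundary D r (fun x => normc (f x)))%E.
Proof.
case: n D n_gt0 domD bndD lipD pq qr => // n D _ [oD _] bD _ pq qr.
have [K K0 HK] := Lp_domain_le oD bD p_ge1 q_ge1 r_ge1 pq qr.
exists K^-1; first by rewrite invr_gt0.
move=> f fC1; set a := Lp_domain D p _; set b := Lp_boundary D r _.
have a0 : (0 <= a)%E by exact: Lnorm_ge0.
have b0 : (0 <= b)%E by exact: Lnorm_ge0.
have [->|aboo] := eqVneq (a + b)%E +oo%E; first by rewrite leey.
have abfin : (a + b)%E \is a fin_num.
  by rewrite ge0_fin_numE ?adde_ge0// lt_neqAle aboo leey.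
(* The normalizing bound must be positive while both norms may vanish, so a + b + e is used for
   every e > 0. *)
apply/lee_addgt0Pr => e e0; rewrite -(fineK abfin) -EFinD.
have ab0 : 0 <= fine (a + b)%E by rewrite fine_ge0 ?adde_ge0.
rewrite lee_pdivrMl// -EFinM.
have abe : (a + b <= (fine (a + b) + e)%:E)%E.
  by rewrite EFinD fineK// leeDl// lee_fin ltW.
apply: HK => //; first by rewrite ltr_wpDl.
  by apply: le_trans abe; rewrite leeDl.
by apply: le_trans abe; rewrite leeDr.
Qed.
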